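(* There are absolute constants $c_1,c_2\geq 1$ such that the following holds. Let $\mathcal{T}\in\mathbb{R}^{n_1\times\cdots\times n_d}$ be a random tensor with i.i.d. standard Gaussian entries. Denote $N:=\prod_i n_i$ and suppose $N\geq 8$. Denote $\overline{n}=\frac1d\sum_{i=1}^d n_i$. Then for any $r\leq\min_i n_i$ and $0<\varepsilon\leq\pi/6$, $$\Pr\Big(\exists\,\mathcal{T}'\text{ of CP rank at most } r\text{ such that }\measuredangle(\mathcal{T},\mathcal{T}')\leq\varepsilon\Big)\;\leq\;\frac{\sin(2\varepsilon)^{N-1}}{\varepsilon^{rd\overline{n}-1}}\cdot\frac{(c_1d)^{rd\overline{n}}\cdot r^{c_2d^2r^2}}{\sqrt{N}\,(c_1)^{dr^2}} \;=\;\mathcal{O}\big(\varepsilon^{N-rd\overline{n}}\big),$$ where the last $\mathcal{O}$ concerns the dependence on $\varepsilon$.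
   Context: A tensor $\mathcal{T}'\in\mathbb{R}^{n_1\times\cdots\times n_d}$ has CP rank at most $r$ if there exist vectors $a_i^{(j)}\in\mathbb{R}^{n_i}$ ($i=1,\dots,d$, $j=1,\dots,r$) with $\mathcal{T}'=\sum_{j=1}^r a_1^{(j)}\otimes\cdots\otimes a_d^{(j)}$. $\measuredangle(\mathcal{T},\mathcal{T}')$ denotes the angle between the (nonzero) tensors $\mathcal{T}$ and $\mathcal{T}'$ under the Frobenius inner product. *)

(* Defs.v *)
From mathcomp Require Export all_boot all_order all_algebra.
From mathcomp Require Export all_classical all_reals all_analysis.
Export Order.TTheory GRing.Theory Num.Theory.
Export numFieldNormedType.Exports.

#[export] Set Implicit Arguments.
#[export] Unset Strict Implicit.
#[export] Unset Printing Implicit Defensive.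

#[local] Open Scope classical_set_scope.
#[local] Open Scope ring_scope.

(* Multi-indices (k_1, ..., k_d) with k_i < n_i. *)
Definition multi_index (d : nat) (n : 'I_d -> nat) : finType :=
  {dffun forall i : 'I_d, 'I_(n i)}.

Notation tensor R n := {ffun multi_index n -> R}.

Section Tensors.
Context {R : realType} {d : nat} {n : 'I_d -> nat}.
Implicit Types S T : tensor R n.

Definition outer_product (a : forall i : 'I_d, 'rV[R]_(n i)) : tensor R n :=
  [ffun k : multi_index n => \prod_(i < d) a i ord0 (k i)].

Definition cp_rank_le (r : nat) T : Prop :=
  exists a : forall i : 'I_d, 'I_r -> 'rV[R]_(n i),
    T = \sum_(j < r) outer_product (fun i => a i j).

Definition frobenius_inner S T : R := \sum_(k : multi_index n) S k * T k.

Definition frobenius_norm T : R := Num.sqrt (frobenius_inner T T).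

(* Meant for nonzero tensors; otherwise the quotient is 0 by the
   convention on division and the value is pi / 2. *)
Definition tensor_angle S T : R :=
  acos (frobenius_inner S T / (frobenius_norm S * frobenius_norm T)).

End Tensors.

Definition mutually_independent (R : realType) (disp : measure_display)
    (Omega : measurableType disp) (P : probability Omega R) (I : finType)
    (X : I -> {RV P >-> R}) : Prop :=
  forall (J : {set I}) (B : I -> set R), (forall i, measurable (B i)) ->
    P [set w | forall i, i \in J -> B i (X i w)] =
    (\prod_(i in J) P (X i @^-1` B i))%E.

Definition iid_standard_gaussian (R : realType) (disp : measure_display)
    (Omega : measurableType disp) (P : probability Omega R) (I : finType)
    (X : I -> {RV P >-> R}) : Prop :=
  mutually_independent X /\
  (forall (i : I) (A : set R), measurable A ->
     distribution P (X i) A = normal_prob 0 1 A).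

Definition random_tensor (R : realType) (disp : measure_display)
    (Omega : measurableType disp) (P : probability Omega R)
    (d : nat) (n : 'I_d -> nat) (X : multi_index n -> {RV P >-> R})
    (w : Omega) : tensor R n :=
  [ffun k => X k w].

Definition num_entries (d : nat) (n : 'I_d -> nat) : nat := \prod_(i < d) n i.

Definition mean_dim (R : realType) (d : nat) (n : 'I_d -> nat) : R :=
  d%:R^-1 * \sum_(i < d) (n i)%:R.

Definition approx_cp_rank_le (R : realType) (d : nat) (n : 'I_d -> nat)
    (r : nat) (eps : R) : set (tensor R n) :=
  [set T | T != 0 /\ exists T' : tensor R n,
     [/\ T' != 0, cp_rank_le r T' & tensor_angle T T' <= eps]].

Definition cp_tube_bound (R : realType) (c1 c2 : R) (d : nat)
    (n : 'I_d -> nat) (r : nat) (eps : R) : R :=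
  let N := num_entries n in
  let rdn := r%:R * d%:R * mean_dim R n in
  (sin (2 * eps) ^+ N.-1 / eps `^ (rdn - 1)) *
  (((c1 * d%:R) `^ rdn * r%:R `^ (c2 * d%:R ^+ 2 * r%:R ^+ 2)) /
   (Num.sqrt N%:R * c1 ^+ (d * r ^ 2))).

(* Main.v *)
Require Import Defs.
From mathcomp Require Import measurable_realfun ring lra zify.

Local Open Scope classical_set_scope.
Local Open Scope ring_scope.

(** The probability that a Gaussian tensor makes an angle at most eps with the
    tensors of CP rank at most r is bounded by a union bound: cover the unit
    tensors of CP rank at most r by a net of spacing of order eps, and bound
    the Gaussian measure of the cone around each point of the net.

    The size of the net is the delicate point, because the tensors of bounded
    CP rank are not the image of a bounded Lipschitz map: the summands may be
    huge and cancel.  It is controlled by linear algebra.  Write s(y, y') for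
    1 - <y, y'>^2, the squared sine of the angle between two unit tensors.  If
    Q is a polynomial of degree m, the matrix of the numbers Q(<y_a, y_b>^2)
    over a family of unit tensors of CP rank at most r has small rank: with
    |y|^2 = 1 used to homogenize, each of its columns is the restriction of a
    function of the CP parameters that is homogeneous of degree 2m in each of
    the d factor matrices, so the rank is at most the number of monomials of
    that shape ([cp_kernel_rank], [card_block_exponents]).  On the other hand
    (tr A)^2 <= rank A * |A|_F^2 ([mxtrace_sqr_le_rank]).  Choosing Q as a
    power of a Dirichlet kernel, so that Q(1) = 1 and Q decays polynomially
    away from 1 ([exists_decay_poly], [packing_kernel]), the Frobenius norm is
    governed by the numbers of points at each dyadic distance, which are
    packing numbers at smaller scales.  Induction on the scale
    ([packing_bound]) shows that a family whose squared sines are at least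
    eta^2 has at most (C q^2 / eta)^p members, up to a constant, where
    p = r (n_1 + ... + n_d) - d and q is the number of factors with more than
    one parameter.  No logarithm of 1 / eta is lost, and the exponent p is at
    most r (n_1 + ... + n_d) - 1.

    For a unit tensor v, the probability of the cone
    <X, v>^2 >= (1 - s^2) |X|^2 is bounded by Markov's inequality applied to
    exp (l (<X, v>^2 - (1 - s^2) |X|^2)).  The expectation is computed exactly
    ([gaussian_quadratic_mgf]): an auxiliary Gaussian variable makes the
    exponent linear in <X, v>, after which the coordinates separate by
    independence ([independent_integral_prod]).  A suitable l
    gives 2 sqrt N s^(N-1) ([gaussian_cone_bound]).

    With a net of spacing sin eps / 4 the cones have sine (5/4) sin eps, which
    is at most (3/4) sin (2 eps).  The spare factor (3/4)^(N-1) absorbs the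
    surplus power of q, since N grows at least like 2^q p / q
    ([num_entries_modes], [modes_absorption]), and N <= 2^p absorbs the powers
    of N; the other constants go into c1 and c2 ([constants_absorption]).

    The event is measurable because it is a countable union of projections of
    closed conditions along a compact box of CP parameters
    ([measurable_exists_in_box]). *)

(** * Trace and rank *)

Lemma cauchy_schwarz (R : realFieldType) (I : finType) (x y : I -> R) :
  (\sum_i x i * y i) ^+ 2 <= (\sum_i x i ^+ 2) * (\sum_i y i ^+ 2).
Proof.
have [y0|y0] := eqVneq (\sum_i y i ^+ 2) 0.
  have yi i : y i = 0.
    apply/eqP; rewrite -sqrf_eq0; apply/eqP.
    by apply: (psumr_eq0P _ y0) => // j _; exact: sqr_ge0.
  by rewrite big1 ?expr0n ?y0 ?mulr0 //= => i _; rewrite yi mulr0.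
have y_gt0 : 0 < \sum_i y i ^+ 2 by rewrite lt_def y0 sumr_ge0 // => i _; exact: sqr_ge0.
set X := \sum_i x i ^+ 2; set Y := \sum_i y i ^+ 2; set S := \sum_i x i * y i.
have : 0 <= \sum_i (Y * x i - S * y i) ^+ 2.
  by apply: sumr_ge0 => i _; exact: sqr_ge0.
have -> : \sum_i (Y * x i - S * y i) ^+ 2 = Y * (X * Y - S ^+ 2).
  transitivity (\sum_i (Y ^+ 2 * x i ^+ 2 + ((- 2 * Y * S) * (x i * y i) + S ^+ 2 * y i ^+ 2))).
    by apply: eq_bigr => i _; ring.
  by rewrite !big_split /= -!mulr_sumr -/X -/Y -/S; ring.
by rewrite pmulr_rge0 // subr_ge0.
Qed.

(** The orthogonal projection P onto the column space of A satisfies P A = A, so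
    tr A is the Frobenius inner product of P and A, and |P|_F^2 = tr P is the
    rank of A.  This is how a large trace forces a large rank without spectral
    theory, symmetry included. *)
Lemma mxtrace_sqr_le_rank (R : realFieldType) (k : nat) (A : 'M[R]_k) :
  (\tr A) ^+ 2 <= (\rank A)%:R * \sum_i \sum_j A i j ^+ 2.
Proof.
pose B := col_base A; pose h := \rank A.
have Bfull (x : 'cV[R]_h) : B *m x = 0 -> x = 0.
  move=> Bx0.
  have /row_fullP[B' B'B] := col_base_full A.
  by rewrite -[RHS](mulmx0 _ B') -Bx0 mulmxA B'B mul1mx.
have BA : B *m row_base A = A by exact: mulmx_base.
clearbody B.
pose G := B^T *m B.
have Gunit : G \in unitmx.
  rewrite -row_free_unit -kermx_eq0; apply/eqP/row_matrixP => i; rewrite row0.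
  set u := row i _.
  have uG : u *m G = 0 by rewrite -row_mul mulmx_ker row0.
  have BuT : B *m u^T = 0.
    have : (B *m u^T)^T *m (B *m u^T) = 0.
      by rewrite trmx_mul trmxK -!mulmxA (mulmxA B^T) (mulmxA u) uG mul0mx.
    move/matrixP/(_ 0 0); rewrite !mxE => S0.
    apply/matrixP => a b; rewrite ord1 [RHS]mxE; apply/eqP.
    have S0' : \sum_j ((B *m u^T) j 0) ^+ 2 = 0.
      by rewrite -[RHS]S0; apply: eq_bigr => j _; rewrite [(_^T) _ _]mxE expr2.
    rewrite -sqrf_eq0; apply/eqP.
    by apply: (psumr_eq0P _ S0') => // j _; exact: sqr_ge0.
  by apply: trmx_inj; rewrite trmx0; exact: Bfull.
(* The orthogonal projection onto the column space of A. *)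
pose P := B *m invmx G *m B^T.
have PT : P^T = P.
  by rewrite /P !trmx_mul trmxK trmx_inv trmx_mul trmxK mulmxA.
have PP : P *m P = P.
  by rewrite /P -!mulmxA (mulmxA B^T) (mulmxA (invmx G) (B^T *m B)) mulVmx // mul1mx.
have PA : P *m A = A.
  have : P *m (B *m row_base A) = B *m row_base A.
    rewrite /P !mulmxA -(mulmxA _ B^T B) -/G.
    by rewrite -(mulmxA B) mulVmx // mulmx1.
  by rewrite BA.
have trP : \tr P = h%:R.
  by rewrite /P mxtrace_mulC mulmxA -/G mulmxV // mxtrace1.
have -> : \tr A = \sum_(ij : 'I_k * 'I_k) P ij.1 ij.2 * A ij.2 ij.1.
  rewrite -{1}PA /mxtrace -(pair_bigA _ (fun i j => P i j * A j i)) /=.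
  by apply: eq_bigr => i _; rewrite mxE.
apply: le_trans (cauchy_schwarz _ _) _.
have -> : \sum_(ij : 'I_k * 'I_k) P ij.1 ij.2 ^+ 2 = h%:R.
  rewrite -trP -{2}PP /mxtrace -(pair_bigA _ (fun i j => P i j ^+ 2)) /=.
  apply: eq_bigr => i _; rewrite mxE; apply: eq_bigr => j _.
  by rewrite -{3}PT [P^T _ _]mxE expr2.
by rewrite -(pair_bigA _ (fun i j => A j i ^+ 2)) /= exchange_big.
Qed.

(** * A polynomial with a sharp peak at the origin *)

(** With x = sin^2 u, the first component is the Dirichlet kernel
    sin ((2l+1) u) / sin u.  The second component is the kernel for l - 1, kept
    so that the three-term recurrence is structural; for l = 0 it is
    sin (- u) / sin u = - 1. *)
Fixpoint dirichlet_pair (R : realType) (l : nat) : {poly R} * {poly R} :=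
  if l is l'.+1 then
    let: (w, v) := dirichlet_pair R l' in ((2 - 4 *: 'X) * w - v, w)
  else (1, - 1).

Lemma horner_dirichlet_step (R : realType) (w v : {poly R}) (y : R) :
  ((2 - 4 *: 'X) * w - v).[y] = (2 - 4 * y) * w.[y] - v.[y].
Proof. by rewrite !hornerE; ring. Qed.

Lemma dirichlet_pair_sin (R : realType) (l : nat) (x : R) :
  sin ((2 * l%:R + 1) * x) = sin x * (dirichlet_pair R l).1.[sin x ^+ 2] /\
  sin ((2 * l%:R - 1) * x) = sin x * (dirichlet_pair R l).2.[sin x ^+ 2].
Proof.
elim: l => [|l [IH1 IH2]] /=.
  by rewrite mulr0 add0r sub0r mul1r mulN1r sinN !hornerE; split; ring.
case: (dirichlet_pair R l) IH1 IH2 => w v /= IH1 IH2; split; last first.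
  by rewrite -IH1 -natr1; congr sin; ring.
rewrite horner_dirichlet_step.
have e1 : (2 * l.+1%:R + 1) * x = (2 * l%:R + 1) * x + 2 * x by rewrite -natr1; ring.
have e2 : (2 * l%:R - 1) * x = (2 * l%:R + 1) * x - 2 * x by ring.
have -> : sin x * ((2 - 4 * sin x ^+ 2) * w.[sin x ^+ 2] - v.[sin x ^+ 2]) =
   (2 - 4 * sin x ^+ 2) * (sin x * w.[sin x ^+ 2]) - sin x * v.[sin x ^+ 2] by ring.
rewrite -IH1 -IH2 e1 e2 sinD sinB.
have -> : cos (2 * x) = 1 - 2 * sin x ^+ 2.
  by rewrite mulr_natl mulr2n cosD; have := cos2Dsin2 x; nra.
ring.
Qed.

Lemma sin_natmul_le (R : realType) (l : nat) (x : R) :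
  `|sin (l%:R * x)| <= l%:R * `|sin x|.
Proof.
elim: l => [|l IH]; first by rewrite !mul0r sin0 normr0.
rewrite -natr1 !mulrDl !mul1r sinD (le_trans (ler_normD _ _)) // lerD //.
  rewrite normrM (le_trans _ IH) // ler_piMr // ler_norml.
  by rewrite cos_geN1 cos_le1.
by rewrite normrM ler_piMl // ler_norml cos_geN1 cos_le1.
Qed.

Lemma size_dirichlet_pair (R : realType) (l : nat) :
  (size (dirichlet_pair R l).1 <= l.+1)%N /\ (size (dirichlet_pair R l).2 <= l.+1)%N.
Proof.
elim: l => [|l] /=; first by rewrite size_polyN size_poly1.
case: (dirichlet_pair R l) => w v /= [sw sv]; split; last exact: leq_trans sw _.
rewrite (leq_trans (size_polyD _ _)) // size_polyN geq_max (leq_trans sv) // andbT.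
rewrite (leq_trans (size_polyMleq _ _)) //.
have s2 : (size ((2 - 4 *: 'X)%R : {poly R}) <= 2)%N.
  rewrite (leq_trans (size_polyD _ _)) // geq_max size_polyN.
  rewrite (leq_trans (size_scale_leq _ _)) ?size_polyX // andbT.
  by rewrite -polyC_natr (leq_trans (size_polyC_leq1 _)).
by rewrite -[l.+2]/(2 + l.+1).-1 -!subn1 leq_sub2r // leq_add.
Qed.

(** The Dirichlet kernel divided by its value 2l+1 at the origin.  The two bounds
    are |sin (L u)| <= L |sin u| and |sin (L u)| <= 1 with L = 2l+1: the peak has
    width 1 / L in sin u although the degree is only l, which is the gain over
    a power of 1 - x and the reason for the correct exponent of eps. *)
Lemma exists_decay_poly (R : realType) (l : nat) :
  exists g : {poly R}, [/\ (size g <= l.+1)%N, g.[0] = 1 &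
    forall x, 0 <= x <= 1 ->
      g.[x] ^+ 2 <= 1 /\ (l.*2.+1)%:R ^+ 2 * x * g.[x] ^+ 2 <= 1].
Proof.
pose L : R := (l.*2.+1)%:R.
have LE : L = 2 * l%:R + 1 by rewrite /L -natr1 -mul2n natrM.
have L0 : L != 0 by rewrite pnatr_eq0.
have w0 m : (dirichlet_pair R m).1.[0] = 2 * m%:R + 1 /\
            (dirichlet_pair R m).2.[0] = 2 * m%:R - 1.
  elim: m => [|m] /=; first by rewrite !hornerE; split; ring.
  case: (dirichlet_pair R m) => w v /= [hw hv].
  by rewrite horner_dirichlet_step hw hv -natr1; split; ring.
exists (L^-1 *: (dirichlet_pair R l).1); split.
- exact: leq_trans (size_scale_leq _ _) (size_dirichlet_pair _ _).1.
- by rewrite hornerZ (w0 l).1 -LE mulVf.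
move=> x /andP[x0 x1].
pose t := asin (Num.sqrt x).
have st : sin t = Num.sqrt x.
  rewrite asinK // in_itv /= (le_trans _ (sqrtr_ge0 _)) ?oppr_le0 //=.
  by rewrite -sqrtr1 ler_sqrt.
have st2 : sin t ^+ 2 = x by rewrite st sqr_sqrtr.
have := (dirichlet_pair_sin l t).1; rewrite st2 -LE => e.
rewrite hornerZ exprMn; split; last first.
  rewrite (_ : _ * _ = sin (L * t) ^+ 2); last first.
    by rewrite e exprMn st2 exprVn; field.
  by rewrite -[sin _ ^+ 2]real_normK ?num_real // exprn_ile1 // ler_norml sin_geN1 sin_le1.
have [->|xn0] := eqVneq x 0; first by rewrite (w0 l).1 -LE -exprMn mulVf // expr1n.
have x_gt0 : 0 < x by rewrite lt_def xn0.
have : sin (L * t) ^+ 2 <= L ^+ 2 * x.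
  rewrite -st2 -exprMn -[sin _ ^+ 2]real_normK ?num_real //.
  rewrite -[X in _ <= X]real_normK ?num_real // lerXn2r ?nnegrE //.
  by rewrite normrM [`|L|]ger0_norm ?ler0n // sin_natmul_le.
rewrite e exprMn st2 => h.
rewrite exprVn mulrC ler_pdivrMr ?exprn_even_gt0 // mul1r.
by rewrite -(ler_pM2l x_gt0) [X in _ <= X]mulrC.
Qed.

(** * Functions homogeneous in each block of variables *)

(** Exponents of the monomials of degree t in each block of variables, where
    [beta] sends a variable to its block; each exponent is then at most t. *)
Definition block_exponents (T B : finType) (beta : T -> B) (t : nat) :
    {set {ffun T -> 'I_t.+1}} :=
  [set e : {ffun T -> 'I_t.+1} |
    [forall b, (\sum_(x | beta x == b) (e x : nat))%N == t]].

Definition block_homogeneous (R : realType) (T B : finType) (beta : T -> B)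
    (t : nat) (F : (T -> R) -> R) : Prop :=
  exists c : {ffun T -> 'I_t.+1} -> R, forall a : T -> R,
    F a = \sum_(e in block_exponents beta t) c e * \prod_x a x ^+ e x.

Section BlockHomogeneous.
Variables (R : realType) (T B : finType) (beta : T -> B).
Local Notation bh := (@block_homogeneous R T B beta).
Implicit Types (F G : (T -> R) -> R) (t : nat).

Lemma block_homogeneous_ext t F G : F =1 G -> bh t F -> bh t G.
Proof. by move=> FG [c Hc]; exists c => a; rewrite -FG. Qed.

Lemma block_homogeneous0 t : bh t (fun=> 0).
Proof. by exists (fun=> 0) => a; rewrite big1 // => e _; rewrite mul0r. Qed.

Lemma block_homogeneousD t F G : bh t F -> bh t G -> bh t (fun a => F a + G a).
Proof.
move=> [c Hc] [c' Hc']; exists (fun e => c e + c' e) => a.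
by rewrite Hc Hc' -big_split /=; apply: eq_bigr => e _; rewrite mulrDl.
Qed.

Lemma block_homogeneousZ t (k : R) F : bh t F -> bh t (fun a => k * F a).
Proof.
move=> [c Hc]; exists (fun e => k * c e) => a.
by rewrite Hc mulr_sumr; apply: eq_bigr => e _; rewrite mulrA.
Qed.

Lemma block_homogeneous_sum t (I : Type) (r : seq I) (P : pred I) (F : I -> (T -> R) -> R) :
  (forall i, P i -> bh t (F i)) -> bh t (fun a => \sum_(i <- r | P i) F i a).
Proof.
move=> H; elim: r => [|i r IH].
  by apply: block_homogeneous_ext (block_homogeneous0 t) => a; rewrite big_nil.
case Pi: (P i); last by apply: block_homogeneous_ext IH => a; rewrite big_cons Pi.
by apply: block_homogeneous_ext (block_homogeneousD (H i Pi) IH) => a; rewrite big_cons Pi.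
Qed.

Lemma block_homogeneous_monomial t (e : {ffun T -> 'I_t.+1}) : e \in block_exponents beta t ->
  bh t (fun a => \prod_x a x ^+ e x).
Proof.
move=> he; exists (fun e' => (e' == e)%:R) => a.
rewrite (bigD1 e) //= eqxx mul1r [X in _ + X]big1 ?addr0 // => e' /andP[_ /negbTE ->].
by rewrite mul0r.
Qed.

Lemma block_homogeneous1 : bh 0 (fun=> 1).
Proof.
have he : [ffun=> ord0] \in block_exponents beta 0.
  by rewrite inE; apply/forallP => b; rewrite big1 // => x _; rewrite ffunE.
apply: block_homogeneous_ext (block_homogeneous_monomial he) => a.
by rewrite big1 // => x _; rewrite ffunE expr0.
Qed.

(** Multiplying by one variable of each block raises the degree by one in every
    block; a coefficient of an outer product is exactly such a product. *)
Lemma block_homogeneous_mul_transversal t F (s : B -> T) : cancel s beta -> bh t F ->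
  bh t.+1 (fun a => (\prod_b a (s b)) * F a).
Proof.
move=> sK [c Hc].
apply: (@block_homogeneous_ext _ (fun a => \sum_(e in block_exponents beta t)
    c e * ((\prod_b a (s b)) * \prod_x a x ^+ e x))).
  by move=> a; rewrite Hc mulr_sumr; apply: eq_bigr => e _; rewrite mulrCA.
apply: block_homogeneous_sum => e he; apply: block_homogeneousZ.
pose e' : {ffun T -> 'I_t.+2} := [ffun x => inord (e x + (s (beta x) == x))].
have e'E x : e' x = (e x + (s (beta x) == x))%N :> nat.
  rewrite ffunE inordK //.
  by case: eqP; rewrite ?addn1 ?addn0 ltnS // ltnW // ltnS.
have he' : e' \in block_exponents beta t.+1.
  rewrite inE; apply/forallP => b; apply/eqP.
  move: he; rewrite inE => /forallP/(_ b)/eqP he.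
  under eq_bigr => x _ do rewrite e'E.
  rewrite big_split /= he -addn1; congr addn.
  rewrite (bigD1 (s b)) ?sK //= eqxx big1 // => x /andP[/eqP -> ].
  by rewrite eq_sym => /negbTE ->.
apply: block_homogeneous_ext (block_homogeneous_monomial he') => a.
under eq_bigr => x _ do rewrite e'E exprD.
rewrite big_split /= mulrC; congr (_ * _).
rewrite [RHS](reindex_onto beta s) /=; last by move=> b _; exact: sK.
rewrite [RHS]big_mkcond; apply: eq_bigr => x _.
by case: eqP => [->|_]; rewrite ?expr1 ?expr0.
Qed.

(** Evaluation factors through the coefficients, so the rank does not see how
    many points or functions there are. *)
Lemma block_homogeneous_matrix_rank t (k : nat) (F : 'I_k -> (T -> R) -> R) (a : 'I_k -> T -> R) :
  (forall j, bh t (F j)) ->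
  (\rank (\matrix_(i < k, j < k) F j (a i)) <= #|block_exponents beta t|)%N.
Proof.
move=> H; have /choice[c Hc] := H.
pose M := block_exponents beta t.
pose U : 'M[R]_(k, #|M|) := \matrix_(i, m) \prod_x a i x ^+ (enum_val m : {ffun T -> 'I_t.+1}) x.
pose V : 'M[R]_(#|M|, k) := \matrix_(m, j) c j (enum_val m).
suff -> : \matrix_(i < k, j < k) F j (a i) = U *m V.
  exact: leq_trans (mxrankM_maxl _ _) (rank_leq_col _).
apply/matrixP => i j; rewrite !mxE Hc big_enum_val /=.
by apply: eq_bigr => m _; rewrite !mxE mulrC.
Qed.

End BlockHomogeneous.

(** Given one distinguished variable [s b] in each block b, the others. *)
Definition free_coords (T B : finType) (beta : T -> B) (s : B -> T) : {set T} :=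
  [set x | s (beta x) != x].

(** Homogeneity determines the exponent of the distinguished variable of each
    block, and the remaining exponents have total at most t times the number of
    blocks that contain another variable.  Only these blocks count, which
    matters when many blocks have a single variable. *)
Lemma card_block_exponents (T B : finType) (beta : T -> B) (s : B -> T) (t : nat) :
  cancel s beta ->
  (#|block_exponents beta t| <=
   'C(#|beta @: free_coords beta s| * t + #|free_coords beta s|,
      #|free_coords beta s|))%N.
Proof.
move=> sK; set Tf := free_coords _ _; set q := #|beta @: Tf|.
rewrite addnC -card_partial_ord_partitions.
(* Forget the distinguished exponents. *)
pose f (e : {ffun T -> 'I_t.+1}) : #|Tf|.-tuple 'I_(q * t).+1 :=
  [tuple inord (e (enum_val i)) | i < #|Tf|].
have eq_le (e : {ffun T -> 'I_t.+1}) x : x \in Tf -> (e x < (q * t).+1)%N.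
  move=> xT; rewrite ltnS.
  have : (e x <= t)%N by rewrite -ltnS.
  move/leq_trans; apply; rewrite leq_pmull // card_gt0.
  by apply/set0Pn; exists (beta x); exact: imset_f.
have fE e i : tnth (f e) i = e (enum_val i) :> nat.
  by rewrite tnth_mktuple inordK // eq_le // enum_valP.
have finj : {in block_exponents beta t &, injective f}.
  move=> e e'; rewrite !inE => /forallP he /forallP he' fee'.
  have Tfe x : x \in Tf -> e x = e' x.
    move=> xT; apply: val_inj => /=.
    by rewrite -(enum_rankK_in xT xT) -!fE fee'.
  apply/ffunP => x; have [xT|] := boolP (x \in Tf); first exact: Tfe.
  rewrite inE negbK => /eqP sx.
  have := eqP (he (beta x)); rewrite -[RHS](eqP (he' (beta x))).
  rewrite (bigD1 x) //= [in RHS](bigD1 x) //= => h; apply: val_inj => /=.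
  move: h; set S := (X in (_ + X)%N = _); set S' := (X in _ = (_ + X)%N).
  suff -> : S = S' by move/addIn.
  apply: eq_bigr => y /andP[/eqP yx yNx]; rewrite Tfe // inE yx sx.
  by rewrite eq_sym.
rewrite -(card_in_imset finj); apply: subset_leq_card; apply/fintype.subsetP => _ /imsetP[e he ->].
rewrite inE big_tuple.
under eq_bigr => i _ do rewrite fE.
rewrite -(big_enum_val (fun x => e x : nat)) /=.
rewrite (partition_big beta (mem (beta @: Tf))) /=; last by move=> x xT; exact: imset_f.
rewrite -sum_nat_const; apply: leq_sum => b _.
move: he; rewrite inE => /forallP/(_ b)/eqP hb; rewrite -[leqRHS]hb.
rewrite [leqRHS](bigID (mem Tf)) /= (eq_bigl _ _ (fun x => andbC _ _)).
exact: leq_addr.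
Qed.

Lemma expR1_le4 (R : realType) : expR (1 : R) <= 4.
Proof.
have h : (1 / 2 : R) <= expR (- (1 / 2)).
  by apply: le_trans (expR_ge1Dx _); lra.
have e0 := expR_gt0 (1 / 2 : R).
have e2 : expR (1 / 2 : R) <= 2.
  move: h; rewrite expRN -(ler_pM2l e0) mulfV ?gt_eqF // => h; lra.
have -> : (1 : R) = 1 / 2 + 1 / 2 by lra.
rewrite expRD; nra.
Qed.

Lemma onePinv_exp_le4 (R : realType) (M : nat) : (0 < M)%N ->
  (1 + M%:R ^-1) ^+ M <= 4 :> R.
Proof.
move=> M0; have MR : 0 < M%:R :> R by rewrite ltr0n.
apply: le_trans (expR1_le4 R).
have -> : expR 1 = expR (M%:R ^-1) ^+ M :> R by rewrite -expRM_natl mulfV ?gt_eqF.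
rewrite lerXn2r ?nnegrE ?expR_ge0 ?addr_ge0 ?invr_ge0 ?(ltW MR) //.
by have := expR_ge1Dx (M%:R ^-1 : R).
Qed.

(** One term of the expansion of (1 + 1/M)^(M p), which is at most 4^p. *)
Lemma bin_le_exp4 (R : realType) (p M : nat) : (0 < M)%N ->
  'C(M * p, p)%:R <= (4 * M%:R) ^+ p :> R.
Proof.
move=> M0.
have MR : 0 < M%:R :> R by rewrite ltr0n.
have h1 : 'C(M * p, p)%:R * M%:R ^- p <= (1 + M%:R ^-1) ^+ (M * p) :> R.
  rewrite addrC exprD1n -exprVn.
  have pM : (p < (M * p).+1)%N by rewrite ltnS leq_pmull.
  rewrite (bigD1 (Ordinal pM)) //= mulr_natl lerDl.
  by apply: sumr_ge0 => i _; rewrite mulrn_wge0 // exprn_ge0 // invr_ge0 ltW.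
have h2 := @onePinv_exp_le4 R M M0.
rewrite exprMn -ler_pdivrMr ?exprn_gt0 // (le_trans h1) //.
by rewrite exprM lerXn2r ?nnegrE ?exprn_ge0 ?addr_ge0 ?invr_ge0 ?(ltW MR).
Qed.

(** * From rank to packing numbers *)

Lemma dyadic_scale (R : realType) (x : R) (m : nat) : 1 <= x ->
  (exists2 j, (j < m)%N & 4 ^+ j <= x <= 4 ^+ j.+1) \/ 4 ^+ m <= x.
Proof.
move=> x1; elim: m => [|m [[j jm jx]|mx]]; first by right; rewrite expr0.
  by left; exists j => //; exact: ltnW.
have [xm|xm] := leP (4 ^+ m.+1) x; first by right.
by left; exists m => //; rewrite mx ltW.
Qed.

Lemma expr_double (R : realType) (x : R) (m : nat) : x ^+ m.*2 = (x ^+ 2) ^+ m.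
Proof. by rewrite -exprM mul2n. Qed.

Lemma expr8E (R : realType) (m : nat) : 8 ^+ m = (4 ^+ m) ^+ 2 / 2 ^+ m :> R.
Proof.
have -> : 8 = 4 ^+ 2 / 2 :> R by field.
by rewrite expr_div_n exprAC.
Qed.

(** A finite family of points with a squared distance [s] that satisfies the
    triangle inequality up to a factor 2, is bounded below by [eta2] off the
    diagonal, and satisfies the rank inequality [s_rank].  The latter is the
    only trace of the algebraic nature of the points. *)
Section Packing.
Variables (R : realType) (I : finType) (s : I -> I -> R) (p q : nat) (eta2 : R).
Hypotheses (p0 : (0 < p)%N) (q0 : (0 < q)%N) (eta0 : 0 < eta2).
Hypothesis s_sym : forall a b, s a b = s b a.
Hypothesis s01 : forall a b, 0 <= s a b.
Hypothesis s_triangle : forall a b c, s a c <= 2 * s a b + 2 * s b c.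
Hypothesis s_sep : forall a b, a != b -> eta2 <= s a b.
Hypothesis s_rank : forall (S : {set I}) (Q : {poly R}) (m : nat),
  (size Q <= m.+1)%N -> Q.[1] = 1 ->
  #|S|%:R ^+ 2 <= ('C(q * m.*2 + p, p))%:R *
    \sum_(a in S) \sum_(b in S) Q.[1 - s a b] ^+ 2.

(** The degree is proportional to the ratio 2^i between the diameter and the
    separation, not to 1 / eta: the peak is rescaled to the diameter.  Raising
    the kernel to the power 2p makes its decay beat the growth, like the p-th
    power of the distance, of the number of points. *)
Lemma packing_kernel (i : nat) :
  exists Q : {poly R}, [/\ (size Q <= (p.*2 * (25 * q * 2 ^ i)).+1)%N, Q.[1] = 1 &
    forall x, 0 <= x <= 4 ^+ i * eta2 ->
      Q.[1 - x] ^+ 2 <= 1 /\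
      forall y, 0 < y -> y <= x / eta2 ->
        Q.[1 - x] ^+ 2 <= ((25 * q%:R) ^- 2 / y) ^+ p.*2].
Proof.
set l := (25 * q * 2 ^ i)%N.
have [g [sg g0 gb]] := exists_decay_poly R l.
pose D := 4 ^+ i * eta2.
have D0 : 0 < D by rewrite mulr_gt0 ?exprn_gt0.
pose u : {poly R} := D^-1 *: (1 - 'X).
have uE x : u.[1 - x] = x / D.
  by rewrite /u hornerZ hornerD hornerN hornerX hornerC; ring.
have su : (size u <= 2)%N.
  rewrite (leq_trans (size_scale_leq _ _)) // -opprB size_polyN.
  by rewrite -[1]/(1%:P) size_XsubC.
exists ((g \Po u) ^+ p.*2); split.
- rewrite (leq_trans (size_poly_exp_leq _ _)) // ltnS mulnC leq_mul2l.
  apply/orP; right.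
  have : (size (g \Po u) <= ((size g).-1 * (size u).-1).+1)%N by exact: size_comp_poly_leq.
  have : ((size g).-1 * (size u).-1 <= l * 1)%N.
    by apply: leq_mul; rewrite -subn1 leq_subLR.
  rewrite muln1; case: (size _) => //= k; lia.
- rewrite horner_exp horner_comp.
  by have := uE 0; rewrite subr0 mul0r => ->; rewrite g0 expr1n.
move=> x /andP[x0 xD].
have x01 : 0 <= x / D <= 1 by rewrite divr_ge0 ?(ltW D0) //= ler_pdivrMr // mul1r.
have [G1 G2] := gb _ x01.
rewrite horner_exp horner_comp uE exprAC; split; first by rewrite exprn_ile1 ?sqr_ge0.
move=> y y0 yx.
set G := g.[_] ^+ 2 in G1 G2 *.
have G0 : 0 <= G by exact: sqr_ge0.
rewrite lerXn2r ?nnegrE // ?divr_ge0 ?invr_ge0 ?sqr_ge0 ?(ltW y0) //.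
have qR : 0 < q%:R :> R by rewrite ltr0n.
have qq : 0 < (25 * q%:R) ^+ 2 :> R by rewrite exprn_gt0 // mulr_gt0.
rewrite ler_pdivlMr // -[leRHS]mul1r ler_pdivlMr // mulrC.
apply: le_trans G2.
have xE : x / eta2 = 4 ^+ i * (x / D).
  by rewrite /D; field; rewrite !gt_eqF // exprn_gt0.
have lE : (25 * q%:R) * 2 ^+ i = l%:R :> R by rewrite /l !natrM natrX.
have lL : l%:R ^+ 2 <= (l.*2.+1)%:R ^+ 2 :> R.
  have ll : (l <= l.*2.+1)%N by rewrite -addnn -addnS leq_addr.
  by apply: lerXn2r; rewrite ?nnegrE ?ler0n ?ler_nat.
apply: (@le_trans _ _ ((25 * q%:R) ^+ 2 * (G * (x / eta2)))).
  by rewrite ler_wpM2l ?(ltW qq) // ler_wpM2l.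
have -> : (25 * q%:R) ^+ 2 * (G * (x / eta2)) = l%:R ^+ 2 * (x / D) * G :> R.
  have e4 : (2 ^+ i) ^+ 2 = 4 ^+ i :> R.
    by rewrite exprAC; congr (_ ^+ _); ring.
  by rewrite -lE xE [in RHS]exprMn e4; ring.
rewrite ler_wpM2r // ler_wpM2r //; by case/andP: x01.
Qed.

(** In the row of a point, the entries at distance about 2^t eta are bounded by
    the kernel, and their number by the induction hypothesis, for all scales
    but the last two; there the crude bound by the number of all points is
    enough, because the kernel is so small that the product with the rank stays
    below one half of the left-hand side.  Working at every scale at once is
    what avoids a factor log (1 / eta). *)
Lemma packing_bound (i : nat) (S : {set I}) :
  {in S &, forall a b, s a b <= 4 ^+ i * eta2} ->
  #|S|%:R <= 4 * (500 * q%:R ^+ 2 * 2 ^+ i) ^+ p :> R.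
Proof.
have [j] := ubnP i; elim: j i S => // j IH i S /ltnSE ij Sdiam.
have [Q [sQ Q1 Qb]] := packing_kernel i.
set k : R := #|S|%:R.
have qR : 1 <= q%:R :> R by rewrite ler1n.
(* The squared kernel is at most w eta^2 / s to the power 2p; w is small enough
   to beat the factor q^2 in the rank. *)
pose w : R := (25 * q%:R) ^- 2.
have w0 : 0 < w by rewrite invr_gt0 exprn_gt0 // mulr_gt0 // ltr0n.
(* The binomial coefficient of the rank bound is C(M p, p) with
   M = 100 q^2 2^i + 1, and 4 M <= 500 q^2 2^i. *)
pose H : R := (500 * q%:R ^+ 2 * 2 ^+ i) ^+ p.
(* Bounds the squared kernel at distances above 2^(i-2) eta. *)
pose tau : R := (16 * w / 4 ^+ i) ^+ p.*2.
have tau0 : 0 <= tau.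
  apply/exprn_ge0/divr_ge0; last by rewrite exprn_ge0 ?ler0n.
  by apply: mulr_ge0 (ltW w0); rewrite ler0n.
have H0 : 0 <= H.
  by apply/exprn_ge0/mulr_ge0; [apply: mulr_ge0|]; rewrite ?exprn_ge0 ?ler0n.
have qw : q%:R ^+ 2 * w = 625^-1.
  by rewrite /w; field; rewrite pnatr_eq0 -lt0n.
have w625 : w <= 625^-1.
  by rewrite -qw ler_peMl ?(ltW w0) // exprn_ege1.
have row_bound a : a \in S -> \sum_(b in S) Q.[1 - s a b] ^+ 2 <= 2 + k * tau.
  move=> aS.
  have pt b : b \in S -> Q.[1 - s a b] ^+ 2 <= (b == a)%:R +
      (\sum_(t < i - 2) (s a b <= 4 ^+ t.+1 * eta2)%R%:R * (w / 4 ^+ t) ^+ p.*2 + tau).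
    move=> bS.
    have sumge0 : 0 <= \sum_(t < i - 2)
        (s a b <= 4 ^+ t.+1 * eta2)%R%:R * (w / 4 ^+ t) ^+ p.*2.
      by apply: sumr_ge0 => t _; rewrite mulr_ge0 // exprn_ge0 // divr_ge0 ?exprn_ge0 // ltW.
    have sD : 0 <= s a b <= 4 ^+ i * eta2 by rewrite s01 Sdiam.
    have [Qle1 Qdec] := Qb _ sD.
    have [_|ba] := eqVneq b a.
      by apply: le_trans Qle1 _; rewrite lerDl addr_ge0.
    rewrite add0r.
    have x1 : 1 <= s a b / eta2 by rewrite ler_pdivlMr // mul1r s_sep // eq_sym.
    have [[t ti /andP[tx xt]]|xi] := dyadic_scale (i - 2) x1.
      rewrite (le_trans (Qdec (4 ^+ t) _ _)) ?exprn_gt0 //.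
      rewrite (bigD1 (Ordinal ti)) //= -addrA.
      rewrite -ler_pdivrMr // xt mul1r lerDl addr_ge0 // sumr_ge0 // => t' _.
      by rewrite mulr_ge0 // exprn_ge0 // divr_ge0 ?exprn_ge0 // ltW.
    rewrite (le_trans (Qdec (4 ^+ i / 16) _ _)) ?divr_gt0 ?exprn_gt0 //.
      rewrite (le_trans _ xi) // ler_pdivrMr //.
      have -> : 16 = 4 ^+ 2 :> R by ring.
      rewrite -exprD addnC.
      apply: ler_weXn2l; first by rewrite ler1n.
      by rewrite -leq_subLR.
    by rewrite invf_div mulrCA mulrA -/tau lerDr.
  apply: le_trans (ler_sum _ pt) _.
  rewrite big_split /= (bigD1 a) //= eqxx big1 ?addr0; last first.
    by move=> b /andP[_ /negbTE ->].
  have -> : 2 = 1 + 1 :> R by [].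
  rewrite -addrA lerD2l big_split /= sumr_const -[tau *+ _]mulr_natl -/k lerD2r.
  rewrite exchange_big /=.
  have level (t : 'I_(i - 2)) :
      \sum_(b in S) (s a b <= 4 ^+ t.+1 * eta2)%R%:R * (w / 4 ^+ t) ^+ p.*2 <=
      8^-1 ^+ t * 2^-1 :> R.
    set W := _ ^+ p.*2; pose St := [set b in S | (s a b <= 4 ^+ t.+1 * eta2)%R].
    have -> : \sum_(b in S) (s a b <= 4 ^+ t.+1 * eta2)%R%:R * W = #|St|%:R * W.
      rewrite mulr_natl -sumr_const big_mkcond [RHS]big_mkcond /=.
      apply: eq_bigr => b _; rewrite inE; case: (b \in S) => //=.
      by case: (_ <= _); rewrite ?mul1r ?mul0r.
    have ti := ltn_ord t.
    have hcard := IH t.+2 St.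
    apply: (@le_trans _ _ (4 * (500 * q%:R ^+ 2 * 2 ^+ t.+2) ^+ p * W)).
      apply: ler_wpM2r.
        by apply/exprn_ge0/divr_ge0; [exact: ltW|rewrite exprn_ge0 ?ler0n].
      apply: hcard.
        by apply: leq_trans ij; rewrite ltn_subRL in ti; rewrite -[t.+2]add2n.
      move=> b c; rewrite !inE => /andP[_ hb] /andP[_ hc].
      apply: le_trans (s_triangle b a c) _; rewrite (s_sym b a) [4 ^+ t.+2]exprS.
      lra.
    rewrite /W expr_double -mulrA -exprMn.
    set X := (X in _ * X ^+ p).
    have XE : X = (2000 * (q%:R ^+ 2 * w) * w) * 8^-1 ^+ t.
      have -> : X = 500 * q%:R ^+ 2 * (4 * 2 ^+ t) * (w / 4 ^+ t) ^+ 2.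
        by rewrite /X -[t.+2]addn2 exprD; ring.
      rewrite exprVn.
      rewrite expr8E.
      by field; rewrite !expf_eq0 !pnatr_eq0 !andbF.
    have c0 : 0 <= 2000 * (q%:R ^+ 2 * w) * w by rewrite qw; lra.
    have c1 : 2000 * (q%:R ^+ 2 * w) * w <= 8^-1 by rewrite qw; lra.
    have t8 : 0 <= (8^-1 : R) ^+ t <= 1.
      have [e0 e1] : 0 <= (8^-1 : R) /\ (8^-1 : R) <= 1 by lra.
      by rewrite exprn_ge0 ?exprn_ile1.
    have X1 : 0 <= X <= 8^-1 * 8^-1 ^+ t.
      by rewrite XE mulr_ge0 ?ler_wpM2r //; case/andP: t8.
    have : X ^+ p <= X.
      rewrite -(prednK p0) exprS ler_piMr //; first by case/andP: X1.
      have [X0 X8] := andP X1.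
      have t1 := (andP t8).2.
      rewrite exprn_ile1 //; lra.
    case/andP: X1 => _; lra.
  apply: le_trans (ler_sum _ (fun t _ => level t)) _.
  rewrite -mulr_suml ler_pdivrMr // mul1r.
  suff : \sum_(t < i - 2) 8^-1 ^+ t <= 8 / 7 * (1 - 8^-1 ^+ (i - 2)) :> R.
    have : 0 <= 8^-1 ^+ (i - 2) :> R by rewrite exprn_ge0.
    lra.
  elim: (i - 2)%N => [|m IHm]; first by rewrite big_ord0 expr0 subrr mulr0.
  by rewrite big_ord_recr /= exprS; lra.
have kk : k ^+ 2 <= H * (k * (2 + k * tau)).
  apply: le_trans (s_rank S sQ Q1) _.
  apply: ler_pM => //.
  - by rewrite sumr_ge0 // => a _; rewrite sumr_ge0 // => b _; exact: sqr_ge0.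
  - have -> : (q * (p.*2 * (25 * q * 2 ^ i)).*2 + p = (100 * q ^ 2 * 2 ^ i + 1) * p)%N.
      by rewrite -!muln2; ring.
    apply: le_trans (bin_le_exp4 _ _ _) _; first by rewrite addn1.
    apply: lerXn2r; rewrite ?nnegrE.
    - by rewrite mulr_ge0 ?ler0n.
    - by apply: mulr_ge0; [apply: mulr_ge0|]; rewrite ?exprn_ge0 ?ler0n.
    rewrite natrD !natrM !natrX.
    have : 1 <= q%:R ^+ 2 * 2 ^+ i :> R.
      by rewrite -[leLHS]mulr1 ler_pM ?exprn_ege1 // ler1n.
    lra.
  - apply: le_trans (ler_sum _ row_bound) _.
    by rewrite sumr_const -[leLHS]mulr_natl.
have Htau : H * tau <= 2^-1.
  rewrite /H /tau expr_double -exprMn.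
  set X := (X in X ^+ p).
  have XE : X = (500 * 256 * (q%:R ^+ 2 * w) * w) * 8^-1 ^+ i.
    rewrite /X exprVn.
    rewrite expr8E.
    by field; rewrite !expf_eq0 !pnatr_eq0 !andbF.
  have c0 : 0 <= 500 * 256 * (q%:R ^+ 2 * w) * w by rewrite qw; lra.
  have c1 : 500 * 256 * (q%:R ^+ 2 * w) * w <= 2^-1 by rewrite qw; lra.
  have t8 : 0 <= (8^-1 : R) ^+ i <= 1.
      have [e0 e1] : 0 <= (8^-1 : R) /\ (8^-1 : R) <= 1 by lra.
      by rewrite exprn_ge0 ?exprn_ile1.
  have X1 : 0 <= X <= 2^-1.
    rewrite XE mulr_ge0 ?(andP t8).1 //= -[leRHS]mulr1 ler_pM //; lra.
  rewrite -(prednK p0) exprS.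
  have : 0 <= X ^+ p.-1 <= 1 by rewrite exprn_ge0 ?exprn_ile1 //; lra.
  nra.
have [->|kn0] := eqVneq k 0; first by rewrite mulr_ge0.
have k0 : 0 < k by rewrite lt_def kn0 ler0n.
rewrite -(ler_pM2l k0) -/H.
have : k ^+ 2 * (H * tau) <= k ^+ 2 * 2^-1 by rewrite ler_wpM2l ?sqr_ge0.
rewrite expr2 in kk *.
have kE : H * (k * (2 + k * tau)) = 2 * (H * k) + k * k * (H * tau) by ring.
rewrite kE in kk.
lra.
Qed.
End Packing.

(** * Tensors of bounded CP rank as multihomogeneous functions *)

(** The entries of the d factor matrices: (i, (j, k)) is the k-th entry of the
    i-th vector of the j-th summand. *)
Definition cp_coord (d : nat) (n : 'I_d -> nat) (r : nat) : finType :=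
  {i : 'I_d & 'I_r * 'I_(n i)}%type.

Definition cp_block d (n : 'I_d -> nat) r (x : cp_coord n r) : 'I_d := tag x.

Definition cp_dim d (n : 'I_d -> nat) r (s : 'I_d -> cp_coord n r) : nat :=
  #|free_coords (@cp_block d n r) s|.

Definition cp_modes d (n : 'I_d -> nat) r (s : 'I_d -> cp_coord n r) : nat :=
  #|(@cp_block d n r) @: free_coords (@cp_block d n r) s|.

Section CP.
Variables (R : realType) (d : nat) (n : 'I_d -> nat) (r : nat).
Local Notation coord := (cp_coord n r).
Implicit Types (a : coord -> R) (y z : tensor R n).

Definition cp_entry (i : 'I_d) (j : 'I_r) (k : 'I_(n i)) : coord :=
  Tagged (fun i => 'I_r * 'I_(n i))%type (j, k).

Definition cp_tensor a : tensor R n :=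
  [ffun k : multi_index n => \sum_(j < r) \prod_(i < d) a (cp_entry j (k i))].

Lemma cp_rank_leP y : cp_rank_le r y <-> exists a, y = cp_tensor a.
Proof.
split=> [[v ->]|[a ->]].
  exists (fun x => v (tag x) (tagged x).1 ord0 (tagged x).2).
  apply/ffunP => k; rewrite ffunE sum_ffunE; apply: eq_bigr => j _.
  by rewrite ffunE.
exists (fun i j => \row_k a (cp_entry j k)).
apply/ffunP => k; rewrite ffunE sum_ffunE; apply: eq_bigr => j _.
by rewrite ffunE; apply: eq_bigr => i _; rewrite mxE.
Qed.

Local Notation bh := (@block_homogeneous R _ _ (@cp_block d n r)).

Lemma block_homogeneous_cp_tensor t F (k : multi_index n) :
  bh t F -> bh t.+1 (fun a => cp_tensor a k * F a).
Proof.
move=> hF; apply: (@block_homogeneous_ext _ _ _ _ _ (fun a => \sum_(j < r)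
    (\prod_(i < d) a (cp_entry j (k i))) * F a)).
  by move=> a; rewrite ffunE mulr_suml.
by apply: block_homogeneous_sum => j _; apply: block_homogeneous_mul_transversal.
Qed.

Lemma block_homogeneous_inner t F y :
  bh t F -> bh t.+1 (fun a => frobenius_inner (cp_tensor a) y * F a).
Proof.
move=> hF; apply: (@block_homogeneous_ext _ _ _ _ _ (fun a => \sum_k y k * (cp_tensor a k * F a))).
  by move=> a; rewrite mulr_suml; apply: eq_bigr => k _; rewrite mulrA [y k * _]mulrC.
by apply: block_homogeneous_sum => k _; apply: block_homogeneousZ; apply: block_homogeneous_cp_tensor.
Qed.

Lemma block_homogeneous_sqnorm t F :
  bh t F -> bh t.+2 (fun a => frobenius_inner (cp_tensor a) (cp_tensor a) * F a).
Proof.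
move=> hF; apply: (@block_homogeneous_ext _ _ _ _ _
    (fun a => \sum_k cp_tensor a k * (cp_tensor a k * F a))).
  by move=> a; rewrite mulr_suml; apply: eq_bigr => k _; rewrite mulrA.
by apply: block_homogeneous_sum => k _; do 2!apply: block_homogeneous_cp_tensor.
Qed.

(** The powers of |y|^2, which is 1 at the points of interest, make all terms
    homogeneous of the same degree; without them the count of monomials would
    have the exponent r (n_1 + ... + n_d), too large by d. *)
Lemma block_homogeneous_kernel (Q : {poly R}) (m : nat) y : (size Q <= m.+1)%N ->
  bh m.*2 (fun a => \sum_(c < m.+1) Q`_c * (frobenius_inner (cp_tensor a) y ^+ 2) ^+ c
     * frobenius_inner (cp_tensor a) (cp_tensor a) ^+ (m - c)).
Proof.
move=> sQ; apply: block_homogeneous_sum => c _.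
apply: (@block_homogeneous_ext _ _ _ _ _ (fun a => Q`_c * (frobenius_inner (cp_tensor a) y ^+ c.*2 *
     frobenius_inner (cp_tensor a) (cp_tensor a) ^+ (m - c)))).
  by move=> a; rewrite -mulrA expr_double.
apply: block_homogeneousZ.
have -> : m.*2 = (c.*2 + (m - c).*2)%N.
  by rewrite -doubleD subnKC // -ltnS.
elim: (c.*2) => [|u IH]; last first.
  by apply: block_homogeneous_ext (block_homogeneous_inner y IH) => a; rewrite exprS mulrA.
rewrite add0n; apply: (@block_homogeneous_ext _ _ _ _ _
  (fun a => frobenius_inner (cp_tensor a) (cp_tensor a) ^+ (m - c))).
  by move=> a; rewrite expr0 mul1r.
elim: (m - c)%N => [|u IH]; first exact: block_homogeneous1.
by rewrite doubleS; apply: block_homogeneous_ext (block_homogeneous_sqnorm IH) => a; rewrite exprS.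
Qed.

Lemma cp_kernel_rank (s : 'I_d -> coord) (k : nat) (y : 'I_k -> tensor R n)
    (Q : {poly R}) (m : nat) :
  cancel s (@cp_block d n r) -> (size Q <= m.+1)%N ->
  (forall i, cp_rank_le r (y i)) ->
  (forall i, frobenius_inner (y i) (y i) = 1) ->
  (\rank (\matrix_(i < k, j < k) Q.[frobenius_inner (y i) (y j) ^+ 2]) <=
    'C(cp_modes s * m.*2 + cp_dim s, cp_dim s))%N.
Proof.
move=> sK sQ ycp y1.
apply: leq_trans (card_block_exponents m.*2 sK).
have /choice[a ya] : forall i, exists a, y i = cp_tensor a.
  by move=> i; apply/cp_rank_leP.
have := block_homogeneous_matrix_rank a (fun j => block_homogeneous_kernel (y j) sQ).
congr (is_true (\rank _ <= _)%N); apply/matrixP => i j; rewrite !mxE -!ya y1.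
rewrite (horner_coef_wide _ sQ); apply: eq_bigr => c _.
by rewrite expr1n mulr1.
Qed.

(** The rank bound and the trace inequality combined: the diagonal of the kernel
    matrix consists of ones. *)
Lemma cp_packing_energy (s : 'I_d -> coord) (I : finType) (y : I -> tensor R n)
    (S : {set I}) (Q : {poly R}) (m : nat) :
  cancel s (@cp_block d n r) -> (size Q <= m.+1)%N -> Q.[1] = 1 ->
  (forall i, cp_rank_le r (y i)) ->
  (forall i, frobenius_inner (y i) (y i) = 1) ->
  #|S|%:R ^+ 2 <= ('C(cp_modes s * m.*2 + cp_dim s, cp_dim s))%:R *
   \sum_(a in S) \sum_(b in S) Q.[frobenius_inner (y a) (y b) ^+ 2] ^+ 2.
Proof.
move=> sK sQ Q1 ycp y1.
have := @cp_kernel_rank s #|S| (y \o enum_val) Q m sK sQ (fun=> ycp _) (fun=> y1 _).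
rewrite -(ler_nat R); set A := \matrix_(i, j) _ => hr.
have trA : \tr A = #|S|%:R.
  rewrite /mxtrace (eq_bigr (fun=> 1)) ?sumr_const ?card_ord //.
  by move=> i _; rewrite mxE /= y1 expr1n.
rewrite -trA; apply: le_trans (mxtrace_sqr_le_rank _) _.
have -> : \sum_i \sum_j A i j ^+ 2 =
   \sum_(a in S) \sum_(b in S) Q.[frobenius_inner (y a) (y b) ^+ 2] ^+ 2.
  rewrite [RHS]big_enum_val; apply: eq_bigr => i _.
  by rewrite [RHS]big_enum_val; apply: eq_bigr => j _; rewrite mxE.
apply: ler_wpM2r => //.
by rewrite sumr_ge0 // => a _; rewrite sumr_ge0 // => b _; exact: sqr_ge0.
Qed.

End CP.

Section Sine.
Variables (R : realType) (d : nat) (n : 'I_d -> nat).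
Implicit Types x y z : tensor R n.
Local Notation "<[ x , y ]>" := (frobenius_inner x y).

Lemma frobenius_innerC x y : <[x, y]> = <[y, x]>.
Proof. by apply: eq_bigr => k _; rewrite mulrC. Qed.

Lemma frobenius_inner_ge0 x : 0 <= <[x, x]>.
Proof. by apply: sumr_ge0 => k _; rewrite -expr2 sqr_ge0. Qed.

Lemma frobenius_inner_gt0 x : x != 0 -> 0 < <[x, x]>.
Proof.
move=> x0; rewrite lt_def frobenius_inner_ge0 andbT; apply: contra x0 => /eqP h.
apply/eqP/ffunP => k; rewrite ffunE; apply/eqP; rewrite -sqrf_eq0 expr2; apply/eqP.
by apply: (psumr_eq0P _ h) => // j _; rewrite -expr2 sqr_ge0.
Qed.

Lemma frobenius_cauchy_schwarz x y : <[x, y]> ^+ 2 <= <[x, x]> * <[y, y]>.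
Proof. exact: cauchy_schwarz. Qed.

Lemma frobenius_innerZl (c : R) x y : <[c *: x, y]> = c * <[x, y]>.
Proof. by rewrite mulr_sumr; apply: eq_bigr => k _; rewrite ffunE mulrA. Qed.

Lemma frobenius_innerZr (c : R) x y : <[x, c *: y]> = c * <[x, y]>.
Proof. by rewrite frobenius_innerC frobenius_innerZl frobenius_innerC. Qed.

(** The distance from x to the line of z is at most its distance to the multiple
    <x, y> <y, z> z, whose difference with x splits as (x - <x, y> y) +
    <x, y> (y - <y, z> z).  The weight l trades the two squared errors. *)
Lemma sine_triangle (l : R) x y z : 0 < l -> <[y, y]> = 1 -> <[z, z]> = 1 ->
  <[x, x]> - <[x, z]> ^+ 2 <=
  (1 + l) * (<[x, x]> - <[x, y]> ^+ 2) +
  (1 + l^-1) * (<[x, x]> * (1 - <[y, z]> ^+ 2)).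
Proof.
move=> l0 y1 z1.
pose c := <[x, y]>; pose e := <[y, z]>.
have normE (u v : tensor R n) (t : R) :
    \sum_k (u k - t * v k) ^+ 2 = <[u, u]> - 2 * t * <[u, v]> + t ^+ 2 * <[v, v]>.
  rewrite /frobenius_inner !mulr_sumr -sumrB -big_split /=.
  by apply: eq_bigr => k _; ring.
apply: (@le_trans _ _ (\sum_k (x k - c * e * z k) ^+ 2)).
  rewrite normE z1.
  have := sqr_ge0 (<[x, z]> - c * e); lra.
apply: (@le_trans _ _ (\sum_k ((1 + l) * (x k - c * y k) ^+ 2 +
    (1 + l^-1) * (c ^+ 2 * (y k - e * z k) ^+ 2)))).
  apply: ler_sum => k _.
  set u := x k - c * y k; set v := c * (y k - e * z k).
  have -> : x k - c * e * z k = u + v by rewrite /u /v; ring.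
  have -> : c ^+ 2 * (y k - e * z k) ^+ 2 = v ^+ 2 by rewrite exprMn.
  have : 0 <= l^-1 * (l * u - v) ^+ 2 by rewrite mulr_ge0 ?sqr_ge0 // invr_ge0 ltW.
  have -> : l^-1 * (l * u - v) ^+ 2 = l * u ^+ 2 - 2 * u * v + l^-1 * v ^+ 2.
    by field; rewrite gt_eqF.
  lra.
rewrite big_split /= -!mulr_sumr lerD //.
  rewrite ler_wpM2l ?addr_ge0 ?(ltW l0) // normE y1 -/c; lra.
rewrite ler_wpM2l ?addr_ge0 ?invr_ge0 ?(ltW l0) // normE y1 z1 -/e.
have -> : 1 - 2 * e * e + e ^+ 2 * 1 = 1 - e ^+ 2 by ring.
apply: ler_wpM2r.
  by rewrite subr_ge0 -[leRHS](mulr1 1) -{1}y1 -z1 frobenius_cauchy_schwarz.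
by rewrite -[leRHS]mulr1 -y1 frobenius_cauchy_schwarz.
Qed.

End Sine.

(** * A net of the unit tensors of bounded CP rank *)

Lemma exists_pow2 (R : realType) (x : R) : 1 <= x ->
  exists i : nat, x <= 2 ^+ i <= 2 * x.
Proof.
move=> x1.
have ex : exists i, x <= 2 ^+ i.
  exists (Num.bound x); apply: le_trans (ltW (archi_boundP _)) _.
    by apply: le_trans x1.
  by rewrite -natrX ler_nat ltnW // ltn_expl.
case: (ex_minnP ex) => i xi imin; exists i; rewrite xi /=.
case: i xi imin => [|i] xi imin; first by rewrite expr0; lra.
rewrite exprS; have : 2 ^+ i < x by rewrite ltNge; apply/negP => /imin; rewrite ltnn.
lra.
Qed.

Section Net.
Variables (R : realType) (d : nat) (n : 'I_d -> nat) (r : nat).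
Variable s : 'I_d -> cp_coord n r.
Hypotheses (sK : cancel s (@cp_block d n r)) (p0 : (0 < cp_dim s)%N).
Implicit Types y z : tensor R n.

Definition unit_cp z := cp_rank_le r z /\ frobenius_inner z z = 1.

Definition sine2 z y : R := 1 - frobenius_inner z y ^+ 2.

Definition separated (eta : R) (k : nat) (y : 'I_k -> tensor R n) :=
  (forall i, unit_cp (y i)) /\ forall i j, i != j -> eta ^+ 2 <= sine2 (y i) (y j).

Lemma cp_modes_gt0 : (0 < cp_modes s)%N.
Proof.
move: p0; rewrite /cp_dim /cp_modes !card_gt0 => /set0Pn[x xT].
by apply/set0Pn; exists (cp_block x); exact: imset_f.
Qed.

Lemma separated_card (eta : R) (k : nat) (y : 'I_k -> tensor R n) :
  0 < eta <= 1 -> separated eta y ->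
  k%:R <= 4 * (1000 * (cp_modes s)%:R ^+ 2 / eta) ^+ cp_dim s :> R.
Proof.
move=> /andP[eta0 eta1] [yu ysep].
have [i /andP[i1 i2]] := @exists_pow2 R (eta^-1) (ltac:(by rewrite invf_ge1)).
have y1 a : frobenius_inner (y a) (y a) = 1 by case: (yu a).
have s0 a b : 0 <= sine2 (y a) (y b).
  by rewrite subr_ge0 (le_trans (frobenius_cauchy_schwarz _ _)) // !y1 mulr1.
have s1 a b : sine2 (y a) (y b) <= 1 by rewrite lerBlDr lerDl sqr_ge0.
have eta2 : 0 < eta ^+ 2 by rewrite exprn_gt0.
have := @packing_bound R _ (fun a b => sine2 (y a) (y b)) (cp_dim s) (cp_modes s)
  (eta ^+ 2) p0 cp_modes_gt0 eta2 _ s0 _ ysep _ i [set: 'I_k].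
rewrite cardsT card_ord => H; apply: le_trans (H _ _ _ _) _.
- by move=> a b; rewrite /sine2 frobenius_innerC.
- move=> a b c; have := @sine_triangle R d n 1 (y a) (y b) (y c) ltr01 (y1 b) (y1 c).
  by rewrite y1 /sine2 invr1 mul1r.
- move=> S Q m sQ Q1.
  have := cp_packing_energy S sK sQ Q1 (fun a => (yu a).1) y1.
  move/le_trans; apply; apply: ler_wpM2l; first by rewrite ler0n.
  apply: ler_sum => a _; apply: ler_sum => b _.
  by rewrite /sine2 opprB addrCA subrr addr0.
- move=> a b _ _; apply: le_trans (s1 _ _) _.
  have -> : 4 = 2 ^+ 2 :> R by ring.
  rewrite exprAC -exprMn exprn_ege1 // -(ler_pM2r eta0).
  have := ler_wpM2r (ltW eta0) i1; rewrite mulVf ?gt_eqF // => h.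
  by rewrite mul1r (le_trans _ (ler_wpM2r (ltW eta0) h)) // mul1r.
rewrite ler_wpM2l ?ler0n //.
have q2 : 0 <= (cp_modes s)%:R ^+ 2 :> R by rewrite exprn_ge0 // ler0n.
have t2 : 0 <= (2 : R) ^+ i by rewrite exprn_ge0 // ler0n.
have e0 : 0 <= eta^-1 by rewrite invr_ge0 ltW.
apply: lerXn2r; rewrite ?nnegrE; [by rewrite !mulr_ge0 ?ler0n|by rewrite !mulr_ge0 ?ler0n|].
have -> : 1000 * (cp_modes s)%:R ^+ 2 / eta =
  500 * (cp_modes s)%:R ^+ 2 * (2 * eta^-1) :> R by ring.
by rewrite ler_wpM2l // mulr_ge0 // ler0n.
Qed.

(** The bound on separated families makes a maximal one exist, and maximality
    says that it is a net. *)
Lemma cp_net (eta : R) : 0 < eta <= 1 ->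
  exists (k : nat) (y : 'I_k -> tensor R n),
  [/\ k%:R <= 4 * (1000 * (cp_modes s)%:R ^+ 2 / eta) ^+ cp_dim s :> R,
      forall i, unit_cp (y i) &
      forall z, unit_cp z -> exists i, sine2 z (y i) < eta ^+ 2].
Proof.
move=> eta01; set M := 4 * _.
pose P k := `[< exists y : 'I_k -> tensor R n, separated eta y >].
have Pex : exists k, P k.
  by exists 0%N; apply/asboolP; exists (fun=> 0); split => -[].
have Pb k : P k -> (k <= Num.bound M)%N.
  move=> /asboolP[y hy]; rewrite -(ler_nat R).
  apply: le_trans (separated_card eta01 hy) _.
  apply: ltW; apply: archi_boundP.
  by apply: le_trans (separated_card eta01 hy); rewrite ler0n.
case: (ex_maxnP Pex Pb) => k /asboolP[y hy] kmax.
exists k, y; split; [exact: separated_card eta01 hy|by case: hy|].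
move=> z zu; apply: contrapT => /forallNP far.
(* A point far from the family would extend it. *)
pose y' (i : 'I_k.+1) := if unlift ord_max i is Some j then y j else z.
have : P k.+1.
  apply/asboolP; exists y'; split => [i|i j].
    by rewrite /y'; case: (unlift _ _) => // j; case: hy.
  rewrite /y'; case: (unliftP ord_max i) => [i' ->|->];
    case: (unliftP ord_max j) => [j' ->|->] ij.
  - by apply: hy.2; apply: contra_neq ij => ->.
  - by rewrite /sine2 frobenius_innerC leNgt; apply/negP/far.
  - by rewrite leNgt; apply/negP/far.
  - by rewrite eqxx in ij.
by move/kmax; rewrite ltnn.
Qed.

End Net.

(** * Layer-cake formula for weighted integrals *)

Section LayerCake.
Context (disp : measure_display) (T : measurableType disp) (R : realType).
Variable mu : {sigma_finite_measure set T -> \bar R}.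
Local Notation lebesgue := (@lebesgue_measure R).

Definition level_set (f : R -> R) (t : R) : set R := [set x | 0 <= t /\ t < f x].

Lemma measurable_level_set (f : R -> R) (t : R) :
  measurable_fun setT f -> measurable (level_set f t).
Proof.
move=> mf; have [t0|t0] := leP 0 t.
  have -> : level_set f t = f @^-1` `]t, +oo[%classic.
    by apply/seteqP; split => x /=; rewrite /level_set /= in_itv /= andbT; [case|].
  by rewrite -[X in measurable X]setTI; apply: mf.
rewrite (_ : level_set f t = set0) //; apply/seteqP; split => x //= -[].
by rewrite leNgt t0.
Qed.

Lemma measurable_layer (h X : T -> R) (f : R -> R) :
  measurable_fun setT h -> measurable_fun setT X -> measurable_fun setT f ->
  measurable_fun setT (fun p : T * measurableTypeR R =>
    (h p.1 * \1_(level_set f p.2) (X p.1))%:E).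
Proof.
move=> mh mX mf.
apply/measurable_EFinP/measurable_funM; first exact: measurableT_comp mh _.
rewrite (_ : (fun p => _) = \1_[set p : T * measurableTypeR R |
    (0 <= p.2) && (p.2 < f (X p.1))]); last first.
  apply/funext => p; rewrite !indicE; congr (nat_of_bool _)%:R.
  by apply/idP/idP; rewrite !inE /level_set /= => /andP.
apply: measurable_indic.
pose f1 (p : T * measurableTypeR R) := 0 <= p.2.
pose f2 (p : T * measurableTypeR R) := p.2 < f (X p.1).
rewrite [X in measurable X](_ : _ = f1 @^-1` [set true] `&` f2 @^-1` [set true]); last first.
  by apply/seteqP; split => p /= => /andP.
apply: measurableI.
- have : measurable_fun setT f1 by exact: measurable_fun_ler.
  by move=> /(_ measurableT [set true]); rewrite setTI; exact.
- have : measurable_fun setT f2.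
    apply: measurable_fun_ltr => //.
    by apply: measurableT_comp mf _; apply: measurableT_comp mX _.
  by move=> /(_ measurableT [set true]); rewrite setTI; exact.
Qed.

Lemma measurable_layer_integral (h X : T -> R) (f : R -> R) :
  measurable_fun setT h -> measurable_fun setT X -> measurable_fun setT f ->
  (forall w, 0 <= h w) ->
  measurable_fun setT (fun t : measurableTypeR R =>
    \int[mu]_w (h w * \1_(level_set f t) (X w))%:E)%E.
Proof.
move=> mh mX mf h0.
apply: (@measurable_fun_fubini_tonelli_G _ _ T (measurableTypeR R) R mu _
  (measurable_layer mh mX mf)).
by move=> p; rewrite lee_fin mulr_ge0.
Qed.

(** Integrals against h of functions of X are determined by those of indicators
    of events of X.  This transfers product formulas, densities and equalities
    of laws from sets to nonnegative functions. *)
Lemma ge0_integral_layer_cake (h X : T -> R) (f : R -> R) :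
  measurable_fun setT h -> measurable_fun setT X -> measurable_fun setT f ->
  (forall w, 0 <= h w) -> (forall x, 0 <= f x) ->
  (\int[mu]_w (h w * f (X w))%:E =
   \int[lebesgue]_t \int[mu]_w (h w * \1_(level_set f t) (X w))%:E)%E.
Proof.
move=> mh mX mf h0 f0.
transitivity (\int[mu]_w \int[lebesgue]_t (h w * \1_(level_set f t) (X w))%:E)%E.
  apply: eq_integral => w _; under eq_integral do rewrite EFinM.
  have E : (fun t => (\1_(level_set f t) (X w) : R)%:E) =
           (fun t => (\1_(`[0, f (X w)[%classic : set R) t : R)%:E).
    apply: funext => t; congr (_%:E); rewrite !indicE; congr (nat_of_bool _)%:R.
    by apply/idP/idP; rewrite !inE /level_set /= in_itv /= => /andP.
  rewrite ge0_integralZl //=.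
  - rewrite E integral_indic //= setIT lebesgue_measure_itv /= lte_fin EFinM.
    have [fX|fX] := ltP 0 (f (X w)); first by rewrite oppr0 adde0.
    by congr (_ * _)%E; congr _%:E; apply/le_anti; rewrite fX f0.
  - rewrite E; apply/measurable_EFinP/measurable_indic; exact: measurable_itv.
  - by rewrite lee_fin.
apply: (@fubini_tonelli _ _ T (measurableTypeR R) R mu lebesgue
  _ (measurable_layer mh mX mf)).
by move=> p; rewrite lee_fin mulr_ge0.
Qed.

End LayerCake.

(** * Products of independent random variables *)

Section Independence.
Context (disp : measure_display) (Omega : measurableType disp) (R : realType).
Variables (P : probability Omega R) (I : finType) (X : I -> {RV P >-> R}).
Hypothesis Xind : mutually_independent X.

Let integrand_measurable (g : I -> R -> R) (Q : pred I) :
  (forall i, measurable_fun setT (g i)) ->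
  measurable_fun setT (fun w => \prod_(i | Q i) g i (X i w)).
Proof.
move=> mg; under eq_fun => w do rewrite -big_filter.
apply: measurable_prod => i _.
by apply: measurableT_comp (mg i) _.
Qed.

Let integral_prod_indic (B : I -> set R) : (forall i, measurable (B i)) ->
  (\int[P]_w (\prod_i (\1_(B i) (X i w) : R))%:E =
   \prod_i \int[P]_w (\1_(B i) (X i w))%:E)%E.
Proof.
move=> mB.
have mX i : measurable (X i @^-1` B i).
  by rewrite -[X in measurable X]setTI; exact: measurable_funPT.
pose E := [set w | forall i, i \in [set: I]%SET -> B i (X i w)].
have EE : E = \bigcap_(i in [set: I]) (X i @^-1` B i).
  apply/seteqP; split => w /= h i; first by move=> _; apply: h; rewrite inE.
  by move=> _; exact: h.
have mE : measurable E.
  by rewrite EE; apply: fin_bigcap_measurable => // ; exact: finite_finset.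
transitivity (\int[P]_w (\1_E w)%:E)%E.
  apply: eq_integral => w _; congr _%:E; rewrite indicE.
  have [/set_mem wE|wE] := boolP (w \in E).
    rewrite big1 // => i _; rewrite indicE mem_set //.
    by apply: wE; rewrite inE.
  apply/eqP/prodf_eq0.
  move: wE; rewrite notin_setE => /existsNP[i /not_implyP[_ nB]].
  by exists i => //; rewrite indicE memNset.
rewrite integral_indic // setIT.
transitivity (\prod_(i in [set: I]%SET) P (X i @^-1` B i))%E; first exact: Xind.
rewrite (eq_bigl xpredT); last by move=> i; rewrite inE.
by apply: eq_bigr => i _; rewrite -[RHS]/(\int[P]_w (\1_(X i @^-1` B i) w)%:E)%E
  integral_indic // setIT.
Qed.

(** For indicators this is the definition of independence.  The factors are then
    generalized one at a time, by the layer-cake formula for the factor at hand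
    with the product of the others as weight. *)
Lemma independent_integral_prod (g : I -> R -> R) :
  (forall i, measurable_fun setT (g i)) -> (forall i x, 0 <= g i x) ->
  (\int[P]_w (\prod_i g i (X i w))%:E = \prod_i \int[P]_w (g i (X i w))%:E)%E.
Proof.
suff H (s : seq I) (f : I -> R -> R) : (forall i, measurable_fun setT (f i)) ->
    (forall i x, 0 <= f i x) ->
    (forall i, i \notin s -> exists2 B, measurable B & f i = \1_B) ->
    (\int[P]_w (\prod_i f i (X i w))%:E = \prod_i \int[P]_w (f i (X i w))%:E)%E.
  move=> mg g0; apply: (H (enum I)) => // i; by rewrite mem_enum.
elim: s f => [|i0 s IH] f mf f0 fB.
  have /choice[B HB] : forall i, exists B, measurable B /\ f i = \1_B.
    by move=> i; have [//|B mB fE] := fB i; exists B.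
  under eq_integral => w _ do under eq_bigr => i _ do rewrite (HB i).2.
  rewrite integral_prod_indic; last by move=> i; exact: (HB i).1.
  by apply: eq_bigr => i _; rewrite (HB i).2.
pose h w := \prod_(i | i != i0) f i (X i w).
have mh : measurable_fun setT h by exact: integrand_measurable.
have h0 w : 0 <= h w by apply: prodr_ge0.
pose c := (\prod_(i | i != i0) \int[P]_w (f i (X i w))%:E)%E.
have c0 : (0 <= c)%E.
  by apply: prode_ge0 => i _; apply: integral_ge0 => w _; rewrite lee_fin.
rewrite [RHS](bigD1 i0) //= -/c.
under eq_integral => w _ do rewrite (bigD1 i0) //= -/(h w) mulrC.
rewrite ge0_integral_layer_cake //.
have step t : (\int[P]_w (h w * \1_(level_set (f i0) t) (X i0 w))%:E =
    c * \int[P]_w (\1_(level_set (f i0) t) (X i0 w))%:E)%E.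
  have mB := measurable_level_set t (mf i0).
  (* The induction hypothesis is used with a level set in place of f i0. *)
  pose f' i := if i == i0 then \1_(level_set (f i0) t) else f i.
  have f'0 : f' i0 = \1_(level_set (f i0) t) by rewrite /f' eqxx.
  have f'N i : i != i0 -> f' i = f i by rewrite /f' => /negbTE ->.
  have f'c : (\prod_(i | i != i0) \int[P]_w (f' i (X i w))%:E = c)%E.
    by apply: eq_bigr => i /f'N ->.
  rewrite -f'c muleC -f'0.
  transitivity (\prod_i \int[P]_w (f' i (X i w))%:E)%E; last by rewrite (bigD1 i0).
  rewrite -IH.
  - apply: eq_integral => w _; rewrite (bigD1 i0) //= mulrC.
    congr (_ * _)%:E; apply: eq_bigr => i ii0.
    by rewrite f'N.
  - move=> i; rewrite /f'; case: eqP => // _; exact: measurable_indic.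
  - by move=> i x; rewrite /f'; case: eqP => // _; rewrite indicE.
  - move=> i si; rewrite /f'; case: eqP => [_|/eqP ii0].
      by exists (level_set (f i0) t).
    by apply: fB; rewrite inE negb_or ii0.
under eq_integral do rewrite step.
rewrite ge0_integralZl //=.
- rewrite muleC; congr (_ * _)%E.
  under [RHS]eq_integral => w _ do rewrite -[f i0 _]mul1r.
  rewrite (@ge0_integral_layer_cake _ _ _ P (cst 1)) //.
  by apply: eq_integral => t _; apply: eq_integral => w _; rewrite mul1r.
- have := @measurable_layer_integral _ _ _ P (cst 1) (X i0) (f i0)
    (measurable_cst _) (measurable_funPT _) (mf i0) (fun=> ler01).
  by under eq_fun => t do under eq_integral => w _ do rewrite mul1r.
- by move=> t _; apply: integral_ge0 => w _; rewrite lee_fin.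
Qed.

End Independence.

(** * Gaussian exponential moments *)

Section Gaussian.
Variable R : realType.
Local Notation lebesgue := (@lebesgue_measure R).

Lemma ge0_integral_normal_prob (f : R -> R) :
  measurable_fun setT f -> (forall x, 0 <= f x) ->
  (\int[normal_prob 0 1]_x (f x)%:E =
   \int[lebesgue]_x (normal_pdf 0 1 x * f x)%:E)%E.
Proof.
move=> mf f0.
have mpdf : measurable_fun [set: R] (normal_pdf 0 1) by exact: measurable_normal_pdf.
rewrite (@ge0_integral_layer_cake _ _ _ lebesgue (normal_pdf 0 1) id) //; last first.
  by move=> x; exact: normal_pdf_ge0.
under [LHS]eq_integral => x _ do rewrite -[f x]mul1r.
rewrite (@ge0_integral_layer_cake _ (measurableTypeR R) R (normal_prob 0 1) (cst 1) id) //.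
apply: eq_integral => t _.
have mB := measurable_level_set t mf.
under eq_integral => x _ do rewrite mul1r.
rewrite integral_indic // setIT /normal_prob [LHS]integral_mkcond.
apply: eq_integral => x _; rewrite patchE indicE.
by case: (x \in _); rewrite ?mulr1 ?mulr0.
Qed.

Definition gauss_weight (alpha kappa x : R) := expR (alpha * x - kappa * x ^+ 2).

Lemma measurable_gauss_weight alpha kappa :
  measurable_fun setT (gauss_weight alpha kappa).
Proof.
apply: measurableT_comp => //; apply: measurable_funB.
  exact: measurable_funM.
by apply: measurable_funM => //; exact: measurable_funX.
Qed.

(** Completing the square turns the integrand into a multiple of a normal
    density. *)
Lemma gaussian_moment (alpha kappa : R) : 0 < 1 + 2 * kappa ->
  (\int[normal_prob 0 1]_x (gauss_weight alpha kappa x)%:E =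
   ((Num.sqrt (1 + 2 * kappa))^-1 *
     expR (alpha ^+ 2 / (2 * (1 + 2 * kappa))))%:E)%E.
Proof.
set v := 1 + 2 * kappa => v0.
have sv0 : 0 < Num.sqrt v by rewrite sqrtr_gt0.
pose s := (Num.sqrt v)^-1; pose m := alpha / v.
have s0 : s != 0 by rewrite invr_eq0 gt_eqF.
have ss : s ^+ 2 = v^-1 by rewrite exprVn sqr_sqrtr // ltW.
rewrite ge0_integral_normal_prob; last 2 first.
- exact: measurable_gauss_weight.
- by move=> x; exact: expR_ge0.
set C := _^-1 * _.
have C0 : 0 <= C by rewrite mulr_ge0 ?expR_ge0 ?invr_ge0 ?ltW.
rewrite -[RHS]mule1 -(integral_normal_pdf m s) -ge0_integralZl //; last 2 first.
- by apply/measurable_EFinP; exact: measurable_normal_pdf.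
- by move=> x _; rewrite lee_fin normal_pdf_ge0.
apply: eq_integral => x _; rewrite -EFinM; congr _%:E.
rewrite !normal_pdfE ?oner_eq0 //.
have peak : normal_peak 1 = s * normal_peak s :> R.
  rewrite /normal_peak ss expr1n mul1r -mulrnAr sqrtrM; last by rewrite invr_ge0 ltW.
  have -> : Num.sqrt v^-1 = s by rewrite sqrtrV // ltW.
  by rewrite invfM mulrA mulfV ?mul1r.
rewrite peak /C -/s.
have -> : s * normal_peak s * normal_fun 0 1 x * gauss_weight alpha kappa x =
  s * normal_peak s * (normal_fun 0 1 x * gauss_weight alpha kappa x) by ring.
rewrite [RHS](_ : _ = s * normal_peak s *
  (expR (alpha ^+ 2 / (2 * v)) * normal_fun m s x)); last by ring.
congr (_ * _); rewrite /normal_fun /gauss_weight -!expRD; congr expR.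
have kE : kappa = (v - 1) / 2 by rewrite /v; field.
rewrite ss /m kE; field.
by rewrite gt_eqF.
Qed.

End Gaussian.

Section Chernoff.
Context (R : realType) (disp : measure_display) (Omega : measurableType disp).
Variables (P : probability Omega R) (I : finType) (X : I -> {RV P >-> R}).
Hypothesis Xiid : iid_standard_gaussian X.

Lemma gaussian_rv_moment (i : I) (alpha kappa : R) : 0 < 1 + 2 * kappa ->
  (\int[P]_w (gauss_weight alpha kappa (X i w))%:E =
   ((Num.sqrt (1 + 2 * kappa))^-1 *
     expR (alpha ^+ 2 / (2 * (1 + 2 * kappa))))%:E)%E.
Proof.
move=> k0; rewrite -gaussian_moment //.
set f := gauss_weight alpha kappa.
have mf : measurable_fun setT f by exact: measurable_gauss_weight.
have f0 x : 0 <= f x by exact: expR_ge0.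
under [LHS]eq_integral => w _ do rewrite -[f _]mul1r.
under [RHS]eq_integral => x _ do rewrite -[f _]mul1r.
rewrite (@ge0_integral_layer_cake _ _ _ P (cst 1) (X i)) //.
rewrite (@ge0_integral_layer_cake _ (measurableTypeR R) R (normal_prob 0 1) (cst 1) id) //.
apply: eq_integral => t _.
have mB := measurable_level_set t mf.
under eq_integral => w _ do rewrite mul1r.
under [RHS]eq_integral => x _ do rewrite mul1r.
transitivity (normal_prob 0 1 (level_set f t)); last first.
  by rewrite integral_indic // setIT.
rewrite -[LHS]/(\int[P]_w (\1_(X i @^-1` level_set f t) w)%:E)%E.
have mXB : measurable (X i @^-1` level_set f t).
  by rewrite -[X in measurable X]setTI; exact: measurable_funPT.
by rewrite integral_indic // setIT; exact: Xiid.2.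
Qed.

(** Since exp (l S^2) is the mean of exp (sqrt (2 l) g S) over a standard Gaussian
    g, the square of the linear form S becomes linear; for fixed g the integrand
    is a product over the coordinates, and the integral over g comes last. *)
Lemma gaussian_quadratic_mgf (v : I -> R) (l c : R) :
  \sum_i v i ^+ 2 = 1 -> 0 < l -> 0 < c -> 2 * l * (1 - c) < 1 ->
  (\int[P]_w (expR (l * ((\sum_i v i * X i w) ^+ 2 - c * \sum_i X i w ^+ 2)))%:E =
   ((Num.sqrt (1 + 2 * (l * c)))^-1 ^+ #|I| *
    (Num.sqrt (1 - 2 * (l / (1 + 2 * (l * c)))))^-1)%:E)%E.
Proof.
move=> v1 l0 c0 lc.
set V := 1 + 2 * (l * c).
have V0 : 0 < V by rewrite addr_gt0 // !mulr_gt0.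
pose b := Num.sqrt (2 * l).
have b2 : b ^+ 2 = 2 * l by rewrite sqr_sqrtr // mulr_ge0 // ltW.
pose S w := \sum_i v i * X i w.
have mS : measurable_fun setT S.
  by apply: measurable_sum => i; apply: measurable_funM.
pose Qn w := \sum_i X i w ^+ 2.
have mQ : measurable_fun setT Qn.
  by apply: measurable_sum => i; apply: measurable_funX.
transitivity (\int[P]_w \int[normal_prob 0 1]_g
    (expR (b * g * S w - l * c * Qn w))%:E)%E.
  apply: eq_integral => w _.
  have E g : expR (b * g * S w - l * c * Qn w) =
      expR (- (l * c * Qn w)) * gauss_weight (b * S w) 0 g.
    by rewrite /gauss_weight -expRD; congr expR; ring.
  under eq_integral => g _ do rewrite E EFinM.
  rewrite ge0_integralZl //; last 2 first.
  - by apply/measurable_EFinP; exact: measurable_gauss_weight.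
  - by move=> g _; rewrite lee_fin expR_ge0.
  rewrite gaussian_moment; last by rewrite mulr0 addr0 ltr01.
  rewrite mulr0 addr0 sqrtr1 invr1 mul1r -EFinM -expRD.
  congr (expR _)%:E; rewrite exprMn b2 -/(S w) -/(Qn w).
  by field.
transitivity (\int[normal_prob 0 1]_g \int[P]_w
    (expR (b * g * S w - l * c * Qn w))%:E)%E.
  apply: (@fubini_tonelli _ _ Omega (measurableTypeR R) R P (normal_prob 0 1)
    (fun p : Omega * measurableTypeR R =>
       (expR (b * p.2 * S p.1 - l * c * Qn p.1))%:E)); last first.
    by move=> p; rewrite lee_fin expR_ge0.
  apply/measurable_EFinP; apply: measurableT_comp => //.
  apply: measurable_funB; apply: measurable_funM => //.
  - exact: measurable_funM.
  - exact: measurableT_comp mS _.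
  - exact: measurableT_comp mQ _.
have inner g : (\int[P]_w (expR (b * g * S w - l * c * Qn w))%:E =
   ((Num.sqrt V)^-1 ^+ #|I|)%:E * (gauss_weight 0 (- (l / V)) g)%:E)%E.
  transitivity (\int[P]_w (\prod_i gauss_weight (b * g * v i) (l * c) (X i w))%:E)%E.
    apply: eq_integral => w _; congr _%:E; rewrite -expR_sum; congr expR.
    rewrite /S /Qn !mulr_sumr -sumrB; apply: eq_bigr => i _.
    by rewrite mulrA.
  rewrite (independent_integral_prod Xiid.1
    (g := fun i => gauss_weight (b * g * v i) (l * c))); last 2 first.
  - by move=> i; exact: measurable_gauss_weight.
  - by move=> i x; exact: expR_ge0.
  under eq_bigr => i _ do rewrite gaussian_rv_moment //.
  rewrite prodEFin -EFinM; congr _%:E.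
  rewrite big_split /= prodr_const -expR_sum; congr (_ * expR _).
  under eq_bigr => i _ do rewrite exprMn mulrAC.
  rewrite -mulr_sumr v1 mulr1 mul0r add0r exprMn b2 -/V; field.
  by rewrite gt_eqF.
under eq_integral => g _ do rewrite inner.
rewrite ge0_integralZl ?lee_fin ?exprn_ge0 ?invr_ge0 ?sqrtr_ge0 //; last 2 first.
- by apply/measurable_EFinP; exact: measurable_gauss_weight.
- by move=> g _; rewrite lee_fin expR_ge0.
rewrite gaussian_moment; last first.
  rewrite mulrN subr_gt0 mulrA ltr_pdivrMr // mul1r /V.
  by rewrite -subr_gt0; move: lc; rewrite -subr_gt0; congr (_ < _); ring.
by rewrite -EFinM mulrN expr0n mul0r expR0 mulr1.
Qed.

End Chernoff.

(** * Gaussian measure of a double cone *)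

Section Cone.
Context (R : realType) (disp : measure_display) (Omega : measurableType disp).
Variables (P : probability Omega R) (I : finType) (X : I -> {RV P >-> R}).
Hypothesis Xiid : iid_standard_gaussian X.

(** The exponential moment is smallest for l slightly below 1 / (2 s^2), where it
    blows up; this l makes 1 - 2 l s^2 equal to 1 / N. *)
Lemma gaussian_cone_mgf_le (s : R) : (2 <= #|I|)%N -> 0 < s < 1 ->
  let l := (1 - #|I|%:R^-1) / (2 * s ^+ 2) in
  let V := 1 + 2 * (l * (1 - s ^+ 2)) in
  [/\ 0 < l, 2 * l * (1 - (1 - s ^+ 2)) < 1 &
  (Num.sqrt V)^-1 ^+ #|I| * (Num.sqrt (1 - 2 * (l / V)))^-1 <=
  2 * Num.sqrt #|I|%:R * s ^+ #|I|.-1].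
Proof.
move=> N2 /andP[s0 s1] l V; set N : R := #|I|%:R in l V *.
have N0 : 0 < N by rewrite ltr0n; apply: leq_trans N2.
have N1 : 1 < N by rewrite ltr1n.
have N1' : 0 < 1 - N^-1 by rewrite subr_gt0 invf_lt1 // ltr1n.
have s20 : 0 < s ^+ 2 by rewrite exprn_gt0.
have l0 : 0 < l.
  by apply: divr_gt0 => //; apply: mulr_gt0.
have lE : 2 * l * s ^+ 2 = 1 - N^-1.
  by rewrite /l -/N; field; rewrite !gt_eqF.
have VE : V = 2 * l + N^-1.
  rewrite /V (_ : 2 * (l * (1 - s ^+ 2)) = 2 * l - 2 * l * s ^+ 2); last by ring.
  by rewrite lE; ring.
have V0 : 0 < V by rewrite VE addr_gt0 ?invr_gt0 // mulr_gt0.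
have sV0 : 0 < Num.sqrt V by rewrite sqrtr_gt0.
split=> //.
  rewrite (_ : 1 - (1 - s ^+ 2) = s ^+ 2); last by ring.
  by rewrite lE ltrBlDr ltrDl invr_gt0.
have -> : 1 - 2 * (l / V) = (N * V)^-1.
  have -> : 1 - 2 * (l / V) = (V - 2 * l) / V by field; rewrite gt_eqF.
  by rewrite VE [_ + _ - _](_ : _ = N^-1) ?invfM //; ring.
rewrite sqrtrV ?(ltW (mulr_gt0 N0 V0)) // invrK sqrtrM ?(ltW N0) //.
have Nsucc : #|I| = #|I|.-1.+1 by rewrite prednK // (leq_trans _ N2).
rewrite {1}Nsucc exprSr -mulrA [_^-1 * (_ * _)]mulrCA mulVf ?gt_eqF // mulr1.
rewrite mulrC -mulrA [2 * _]mulrCA ler_wpM2l ?sqrtr_ge0 //.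
set M := #|I|.-1.
have M0 : (0 < M)%N by rewrite /M -ltnS -Nsucc.
have NM : N = M%:R + 1 by rewrite natr1 -Nsucc.
have MR : 0 < M%:R :> R by rewrite ltr0n.
have key : ((Num.sqrt V)^-1 ^+ M) ^+ 2 <= (2 * s ^+ M) ^+ 2.
  rewrite exprAC exprVn sqr_sqrtr ?(ltW V0) //.
  have -> : (2 * s ^+ M) ^+ 2 = 4 * (s ^+ 2) ^+ M.
    by rewrite exprMn exprAC; congr (_ * _); ring.
  apply: le_trans (ler_wpM2r _ (onePinv_exp_le4 R M0)); last by rewrite exprn_ge0 // ltW.
  rewrite -exprMn lerXn2r ?nnegrE ?invr_ge0 ?(ltW V0) //.
    by rewrite mulr_ge0 ?addr_ge0 ?invr_ge0 ?(ltW MR) ?(ltW s20).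
  have -> : 1 + M%:R^-1 = (1 - N^-1)^-1 :> R.
    rewrite NM; field; rewrite -NM !gt_eqF //=.
    by rewrite NM addrK.
  have -> : (1 - N^-1)^-1 * s ^+ 2 = (2 * l)^-1.
    by rewrite -lE; field; rewrite !gt_eqF.
  have l20 : 0 < 2 * l by rewrite mulr_gt0.
  by rewrite lef_pV2 ?posrE // VE lerDl invr_ge0 ltW.
move: key; rewrite ler_sqr // nnegrE.
- by rewrite exprn_ge0 // invr_ge0 ltW.
- by rewrite mulr_ge0 // exprn_ge0 // ltW.
Qed.

(** Markov's inequality for the exponential moment. *)
Lemma gaussian_cone_bound (v : I -> R) (s : R) :
  (2 <= #|I|)%N -> \sum_i v i ^+ 2 = 1 -> 0 < s < 1 ->
  let A := [set w | (1 - s ^+ 2) * (\sum_i X i w ^+ 2) <= (\sum_i v i * X i w) ^+ 2] in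
  measurable A /\ (P A <= (2 * Num.sqrt #|I|%:R * s ^+ #|I|.-1)%:E)%E.
Proof.
move=> N2 v1 s01 A.
have [l0 lc le] := gaussian_cone_mgf_le N2 s01; set l := (1 - #|I|%:R^-1) / (2 * s ^+ 2) in l0 lc le.
pose c : R := 1 - s ^+ 2; rewrite -/c in lc le.
have c0 : 0 < c.
  by case/andP: s01 => s0 s1; rewrite subr_gt0 expr_lt1 // ltW.
pose F w := l * ((\sum_i v i * X i w) ^+ 2 - c * \sum_i X i w ^+ 2).
have mF : measurable_fun setT F.
  apply: measurable_funM => //; apply: measurable_funB.
    by apply: measurable_funX; apply: measurable_sum => i; apply: measurable_funM.
  apply: measurable_funM => //.
  by apply: measurable_sum => i; apply: measurable_funX.
have AE : A = F @^-1` `[0, +oo[%classic.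
  by apply/seteqP; split => w; rewrite /= in_itv /= andbT /F (pmulr_rge0 _ l0) subr_ge0.
have mA : measurable A.
  by rewrite AE -[X in measurable X]setTI; apply: mF.
split=> //.
apply: (@le_trans _ _ (\int[P]_w (expR (F w))%:E)%E); last first.
  by rewrite (gaussian_quadratic_mgf Xiid v1 l0 c0 lc) lee_fin.
have -> : P A = (\int[P]_w (\1_A w)%:E)%E by rewrite integral_indic // setIT.
apply: ge0_le_integral => //.
- by apply/measurable_EFinP; exact: measurable_indic.
- by apply/measurable_EFinP; apply: measurableT_comp.
move=> w _; rewrite lee_fin indicE.
have [/set_mem|_] := boolP (w \in A); last by rewrite expR_ge0.
rewrite AE /= in_itv /= andbT => Fw.
by apply: le_trans (expR_ge1Dx _); rewrite lerDl.
Qed.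

End Cone.

(** * Measurability of projections of closed conditions *)

(** By compactness, a nonnegative value of the continuous function G w is attained
    in the box as soon as values above any negative number are, and those can be
    looked for at countably many points. *)
Lemma measurable_exists_in_box (R : realType) (disp : measure_display)
    (Omega : measurableType disp) (K : nat) (G : Omega -> 'rV[R]_K -> R) (m : R) :
  0 <= m -> (forall w, continuous (G w)) ->
  (forall u, measurable_fun setT (G ^~ u)) ->
  measurable [set w | exists2 u : 'rV[R]_K, (forall i, `|u ord0 i| <= m) & 0 <= G w u].
Proof.
move=> m0 cG mG.
(* Rational points are clamped to the box so that they stay in a compact set. *)
pose cl (x : R) := Num.max (- m) (Num.min m x).
have clP x : (cl x = m /\ m <= x) \/ (cl x = - m /\ x <= - m) \/ cl x = x.
  have mm : - m <= m by lra.
  rewrite /cl; have [h|h] := leP m x; first by left; rewrite max_r.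
  by right; have [h'|h'] := leP (- m) x; [right|left; rewrite ltW].
pose clamp (z : 'rV[rat]_K) : 'rV[R]_K := \row_i cl (ratr (z ord0 i)).
have clampm z i : `|clamp z ord0 i| <= m.
  rewrite mxE /cl ler_norml le_max lexx /= ge_max ge_min lexx /= andbT; lra.
rewrite (_ : [set w | _] = \bigcap_(j in [set: nat]) \bigcup_(z in [set: 'rV[rat]_K])
    [set w | - j.+1%:R^-1 < G w (clamp z)]); last first.
  apply/seteqP; split => w /=.
    move=> [u um Gu] j _.
    have : - j.+1%:R^-1 < G w u by rewrite (lt_le_trans _ Gu) // oppr_lt0 invr_gt0.
    move=> /(cvgr_gt _ (cG w u)) /nbhs_ballP[e /= e0 ue].
    have /choice[q qu] : forall i : 'I_K, exists q : rat,
        `|cl (ratr q) - u ord0 i| < e.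
      move=> i; have := um i; rewrite ler_norml => /andP[u1 u2].
      have /rat_in_itvoo[q] : u ord0 i - e < u ord0 i + e by lra.
      rewrite in_itv /= => /andP[q1 q2]; exists q.
      rewrite ltr_norml; apply/andP.
      by case: (clP (ratr q)) => [[-> ?]|[[-> ?]|->]]; split; lra.
    exists (\row_i q i) => //=; apply: (ue (clamp (\row_i q i))); split => // i j'.
    by rewrite (ord1 i) mxE mxE /ball /= distrC.
  move=> H.
  pose B : set 'rV[R]_K := [set u | forall i, `[- m, m]%classic (u ord0 i)].
  have cB : compact B.
    by apply: (@rV_compact R K (fun=> `[- m, m]%classic)) => i; exact: segment_compact.
  have inB (u : 'rV[R]_K) : (forall i, `|u ord0 i| <= m) -> B u.
    by move=> h i; rewrite /= in_itv /= -ler_norml.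
  have B0 : B !=set0.
    by exists 0; apply: inB => i; rewrite mxE normr0.
  have [c /set_mem cin cmax] := compact_EVT_max B0 cB (continuous_subspaceT (cG w)).
  exists c; first by move=> i; have := cin i; rewrite /= in_itv /= -ler_norml.
  rewrite leNgt; apply/negP => Gc0.
  pose y := - G w c; have y0 : 0 < y by rewrite oppr_gt0.
  pose j := Num.bound (y^-1).
  have jy : j.+1%:R^-1 < y.
    rewrite invf_plt ?posrE //.
    apply: lt_trans (archi_boundP _) _; first by rewrite invr_ge0 ltW.
    by rewrite ltr_nat.
  have [z _ /= Gz] := H j I.
  have := cmax (clamp z) (mem_set (inB _ (clampm z))).
  move=> h; have := lt_le_trans Gz h; rewrite ltrNl => /(lt_trans jy).
  by rewrite ltxx.
apply: bigcapT_measurable => j; apply: countable_bigcupT_measurable; first exact: countableP.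
move=> z; rewrite (_ : [set w | _] = (G ^~ (clamp z)) @^-1` `]- j.+1%:R^-1, +oo[%classic).
  by rewrite -[X in measurable X]setTI; apply: mG.
by apply/seteqP; split => w /=; rewrite in_itv /= andbT.
Qed.

(** * Measurability of the approximation event *)

Lemma ler_cos_acos (R : realType) (x eps : R) : -1 <= x <= 1 -> 0 <= eps <= pi ->
  (acos x <= eps) = (cos eps <= x).
Proof.
move=> x1 e1.
rewrite -[in RHS](acosK x1) leNgt [RHS]leNgt; congr (~~ _).
by rewrite ltr_cos // in_itv /= ?acos_ge0 ?acos_lepi.
Qed.

Lemma frobenius_norm_gt0 (R : realType) d (n : 'I_d -> nat) (T : tensor R n) :
  T != 0 -> 0 < frobenius_norm T.
Proof. by move=> T0; rewrite sqrtr_gt0 frobenius_inner_gt0. Qed.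

Lemma tensor_angle_le (R : realType) d (n : 'I_d -> nat) (S T : tensor R n) (eps : R) :
  S != 0 -> T != 0 -> 0 <= eps <= pi ->
  (tensor_angle S T <= eps) =
  (cos eps * (frobenius_norm S * frobenius_norm T) <= frobenius_inner S T).
Proof.
move=> S0 T0 e1.
have nST : 0 < frobenius_norm S * frobenius_norm T.
  by rewrite mulr_gt0 ?frobenius_norm_gt0.
rewrite /tensor_angle ler_cos_acos //; first by rewrite ler_pdivlMr.
rewrite -ler_norml normrM normfV (ger0_norm (ltW nST)) ler_pdivrMr // mul1r.
rewrite -[leLHS]sqrtr_sqr -sqrtrM ?frobenius_inner_ge0 // ler_wsqrtr //.
exact: frobenius_cauchy_schwarz.
Qed.

Lemma continuous_rsum (R : realType) (T : topologicalType) (I : Type) (s : seq I)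
    (F : I -> T -> R) :
  (forall i, continuous (F i)) -> continuous (fun x => \sum_(i <- s) F i x).
Proof.
move=> cF x; elim: s => [|i s IH].
  by under eq_fun do rewrite big_nil; exact: cvg_cst.
under eq_fun do rewrite big_cons.
by apply: cvgD => //; exact: cF.
Qed.

Lemma continuous_rprod (R : realType) (T : topologicalType) (I : Type) (s : seq I)
    (F : I -> T -> R) :
  (forall i, continuous (F i)) -> continuous (fun x => \prod_(i <- s) F i x).
Proof.
move=> cF x; elim: s => [|i s IH].
  by under eq_fun do rewrite big_nil; exact: cvg_cst.
under eq_fun do rewrite big_cons.
by apply: cvgM => //; exact: cF.
Qed.

Section Event.
Context (R : realType) (d : nat) (n : 'I_d -> nat) (r : nat).
Context (disp : measure_display) (Omega : measurableType disp).
Variables (P : probability Omega R) (X : multi_index n -> {RV P >-> R}) (eps : R).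
Local Notation K := #|{: cp_coord n r}|.

Let f (u : 'rV[R]_K) : tensor R n := cp_tensor (fun x => u ord0 (enum_rank x)).

Let f_continuous k : continuous (fun u => f u k).
Proof.
rewrite (_ : (fun u => _) = fun u : 'rV[R]_K => \sum_(j < r) \prod_(i < d)
   u ord0 (enum_rank (cp_entry j (k i)))); last first.
  by apply/funext => u; rewrite ffunE.
apply: continuous_rsum => j; apply: continuous_rprod => i.
exact: coord_continuous.
Qed.

Let inner_continuous (S : tensor R n) : continuous (fun u => frobenius_inner S (f u)).
Proof.
apply: continuous_rsum => k; have fk := @f_continuous k.
by move=> u; apply: continuousM; [exact: cst_continuous|exact: fk].
Qed.

Let sqnorm_continuous : continuous (fun u => frobenius_inner (f u) (f u)).
Proof.
apply: continuous_rsum => k; have fk := @f_continuous k.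
by move=> u; apply: continuousM; exact: fk.
Qed.

Let G (m : nat) (w : Omega) (u : 'rV[R]_K) : R :=
  Num.min (frobenius_inner (random_tensor X w) (f u) -
           cos eps * (frobenius_norm (random_tensor X w) * frobenius_norm (f u)))
          (frobenius_inner (f u) (f u) - m.+1%:R^-1).

Let G_continuous m w : continuous (G m w).
Proof.
move=> u.
pose A := fun u : 'rV[R]_K => frobenius_inner (random_tensor X w) (f u) -
  cos eps * (frobenius_norm (random_tensor X w) * frobenius_norm (f u)).
pose B := fun u : 'rV[R]_K => frobenius_inner (f u) (f u) - m.+1%:R^-1.
apply: (@continuous_min R _ A B u).
  apply: continuousB; first exact: inner_continuous.
  apply: continuousM; first exact: cst_continuous.
  apply: continuousM; first exact: cst_continuous.
  apply: (continuous_comp (f := fun u => frobenius_inner (f u) (f u)) (g := Num.sqrt)).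
    exact: sqnorm_continuous.
  exact: sqrt_continuous.
by apply: continuousB; [exact: sqnorm_continuous|exact: cst_continuous].
Qed.

Lemma measurable_random_inner (S : tensor R n) :
  measurable_fun setT (fun w => frobenius_inner (random_tensor X w) S).
Proof.
apply: measurable_sum => k; apply: measurable_funM => //.
by rewrite (_ : (fun w => _) = X k) //; apply/funext => w; rewrite ffunE.
Qed.

Lemma measurable_random_sqnorm :
  measurable_fun setT (fun w => frobenius_inner (random_tensor X w) (random_tensor X w)).
Proof.
apply: measurable_sum => k.
have mk : measurable_fun setT (fun w => random_tensor X w k).
  by rewrite (_ : (fun w => _) = X k) //; apply/funext => w; rewrite ffunE.
exact: measurable_funM.
Qed.

Let G_measurable m u : measurable_fun setT (G m ^~ u).
Proof.
apply: measurable_minr => //; apply: measurable_funB.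
  exact: measurable_random_inner.
apply: measurable_funM => //; apply: measurable_funM => //.
apply: measurableT_comp measurable_random_sqnorm.
by apply: continuous_measurable_fun; exact: sqrt_continuous.
Qed.

(** The condition that T' is nonzero is not closed, so the CP parameters are
    exhausted by the compact sets on which they are bounded by m and |T'|^2 is
    at least 1 / (m+1). *)
Lemma measurable_approx_cp_rank_le : 0 <= eps <= pi ->
  measurable [set w | approx_cp_rank_le r eps (random_tensor X w)].
Proof.
move=> e1.
rewrite (_ : [set w | _] =
  [set w | 0 < frobenius_inner (random_tensor X w) (random_tensor X w)] `&`
  \bigcup_(m in [set: nat]) [set w | exists2 u : 'rV[R]_K,
     (forall i, `|u ord0 i| <= m%:R) & 0 <= G m w u]); last first.
  apply/seteqP; split => w /=.
    move=> [T0 [T' [T'0 /cp_rank_leP[a T'a] ang]]].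
    split; first exact: frobenius_inner_gt0.
    pose u : 'rV[R]_K := \row_i a (enum_val i).
    have fu : f u = T'.
      rewrite T'a; apply/ffunP => k; rewrite !ffunE; apply: eq_bigr => j _.
      by apply: eq_bigr => i _; rewrite mxE enum_rankK.
    have g0 := frobenius_inner_gt0 T'0.
    (* Bounds both the parameters and the inverse of the squared norm. *)
    pose M := \sum_i `|u ord0 i| + (frobenius_inner T' T')^-1.
    have S0 : 0 <= \sum_i `|u ord0 i| by apply: sumr_ge0.
    have M0 : 0 < M by rewrite ltr_wpDl // invr_gt0.
    have MB := archi_boundP (ltW M0).
    exists (Num.bound M) => //; exists u => [i|].
      apply: le_trans (ltW MB); rewrite /M (bigD1 i) //= -addrA lerDl addr_ge0 //.
        exact: sumr_ge0.
      by rewrite invr_ge0 ltW.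
    rewrite /G fu le_min subr_ge0 -tensor_angle_le // ang /= subr_ge0.
    rewrite invf_ple ?posrE //.
    apply: (@le_trans _ _ M); first by rewrite lerDr.
    by apply: (le_trans (ltW MB)); rewrite ler_nat.
  move=> [T0 [m _ [u _]]]; rewrite /G le_min !subr_ge0 => /andP[ang fu0].
  have Tn0 : random_tensor X w != 0.
    apply: contraTneq T0 => ->; rewrite -leNgt /frobenius_inner big1 // => k _.
    by rewrite ffunE mul0r.
  have fn0 : f u != 0.
    apply: contraTneq fu0 => ->; rewrite -ltNge /frobenius_inner big1 ?invr_gt0 //.
    by move=> k _; rewrite ffunE mul0r.
  split=> //; exists (f u); split => //; first by apply/cp_rank_leP; eexists.
  by rewrite tensor_angle_le.
apply: measurableI.
  rewrite (_ : [set w | _] = (fun w => frobenius_inner (random_tensor X w)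
    (random_tensor X w)) @^-1` `]0, +oo[%classic).
    by rewrite -[X in measurable X]setTI; apply: measurable_random_sqnorm.
  by apply/seteqP; split => w /=; rewrite in_itv /= andbT.
apply: bigcup_measurable => m _.
by apply: measurable_exists_in_box.
Qed.

End Event.

(** * The event is covered by cones around the net *)

Lemma sin_mean_value (R : realType) (x : R) : 0 < x ->
  exists2 c, 0 < c < x & sin x = cos c * x.
Proof.
move=> x0.
have [|c cx] := @MVT R sin cos 0 x x0 (fun y _ => is_derive_sin y).
  by apply: continuous_subspaceT => y; exact: continuous_sin.
by rewrite sin0 !subr0 => e; exists c => //; move: cx; rewrite in_itv.
Qed.

Lemma sin_le_id (R : realType) (x : R) : 0 < x -> sin x <= x.
Proof.
move=> x0; have [c _ ->] := sin_mean_value x0.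
by rewrite ler_piMl ?(ltW x0) ?cos_le1.
Qed.

(** From cos (3 u) = 4 cos^3 u - 3 cos u at u = pi / 6. *)
Lemma cos_pi6_ge (R : realType) : 5 / 6 <= cos (pi / 6 : R).
Proof.
set c := cos _.
have pi0 := @pi_gt0 R.
have c0 : 0 < c by apply: cos_gt0_pihalf; apply/andP; split; lra.
have e : pi / 2 = pi / 6 + (pi / 6 + pi / 6) :> R by lra.
have := cos_pihalf R; rewrite e !cosD !sinD -/c.
have := cos2Dsin2 (pi / 6 : R); rewrite -/c; set s := sin _ => h1 h2.
have c34 : c * (4 * c ^+ 2 - 3) = 0.
  by rewrite -[RHS]h2 (_ : 3 = 3 * (c ^+ 2 + s ^+ 2)); [ring|rewrite h1 mulr1].
have {}c34 : 4 * c ^+ 2 - 3 = 0.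
  by apply/eqP; move/eqP: c34; rewrite mulf_eq0 gt_eqF.
rewrite leNgt; apply/negP => cl; nra.
Qed.

Lemma small_angle (R : realType) (eps : R) : 0 < eps <= pi / 6 ->
  [/\ eps <= 1, eps / 2 <= sin eps, sin eps <= 9 / 16 &
      5 / 4 * sin eps <= 3 / 4 * sin (2 * eps)].
Proof.
move=> /andP[e0 e6].
have pi0 := @pi_gt0 R.
have /andP[_ pi4] := pihalf_02 R.
have cosge (c : R) : 0 <= c <= pi / 6 -> 5 / 6 <= cos c.
  move=> /andP[c0 c6]; apply: le_trans (cos_pi6_ge R) _.
  rewrite leNgt ltr_cos ?in_itv /= -?leNgt //; apply/andP; split; lra.
have ce : 5 / 6 <= cos eps by apply: cosge; rewrite ltW.
have [c /andP[c0 cx] se] := sin_mean_value e0.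
have cc : 5 / 6 <= cos c by apply: cosge; rewrite ltW //= ltW // (lt_le_trans cx).
have s2 : eps / 2 <= sin eps by rewrite se mulrC ler_wpM2r ?(ltW e0) //; lra.
have := cos2Dsin2 eps => h.
have s0 : 0 < sin eps by lra.
split=> //; first lra.
  rewrite leNgt; apply/negP => h2; nra.
have -> : 2 * eps = eps + eps by ring.
rewrite sinD; nra.
Qed.

Section Cones.
Context (R : realType) (d : nat) (n : 'I_d -> nat) (r : nat).
Implicit Types (T y z : tensor R n).

Lemma cp_rank_leZ (i0 : 'I_d) (c : R) T : cp_rank_le r T -> cp_rank_le r (c *: T).
Proof.
move=> /cp_rank_leP[a ->]; apply/cp_rank_leP.
exists (fun x => if tag x == i0 then c * a x else a x).
apply/ffunP => k; rewrite !ffunE -[LHS]/(c * _) mulr_sumr; apply: eq_bigr => j _.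
rewrite (bigD1 i0) //= [in RHS](bigD1 i0) //= eqxx mulrA; congr (_ * _).
by apply: eq_bigr => i /negbTE ->.
Qed.

(** The weight 1/4 in the triangle inequality for sines gives
    (5/4) sin^2 eps + 5 (sin eps / 4)^2 = ((5/4) sin eps)^2. *)
Lemma approx_cp_rank_le_cone (i0 : 'I_d) (eps : R) (k : nat) (y : 'I_k -> tensor R n) T :
  0 < eps <= pi / 6 ->
  (forall i, unit_cp r (y i)) ->
  (forall z, unit_cp r z -> exists i, sine2 z (y i) < (sin eps / 4) ^+ 2) ->
  approx_cp_rank_le r eps T ->
  exists i, (1 - (5 / 4 * sin eps) ^+ 2) * frobenius_inner T T <=
            frobenius_inner T (y i) ^+ 2.
Proof.
move=> e1 yu ynet [T0 [T' [T'0 T'cp]]].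
have [ele1 s2 s9 _] := small_angle e1.
have /andP[e0 e6] := e1.
have pi0 := @pi_gt0 R.
rewrite tensor_angle_le //; last by rewrite ltW //=; lra.
have nT := frobenius_norm_gt0 T0; have nT' := frobenius_norm_gt0 T'0.
move=> ang.
pose z := (frobenius_norm T')^-1 *: T'.
have zu : unit_cp r z.
  split; first exact: cp_rank_leZ.
  rewrite frobenius_innerZl frobenius_innerZr.
  rewrite -[X in _ * (_ * X)](sqr_sqrtr (frobenius_inner_ge0 _)).
  by rewrite -/(frobenius_norm T') expr2 mulrA mulrA -expr2; field; rewrite gt_eqF.
have Tz : cos eps * frobenius_norm T <= frobenius_inner T z.
  by rewrite frobenius_innerZr ler_pdivlMl // mulrCA [_ * frobenius_norm T]mulrC.
have c0 : 0 <= cos eps.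
  by apply/ltW/cos_gt0_pihalf; apply/andP; split; lra.
have Tz2 : cos eps ^+ 2 * frobenius_inner T T <= frobenius_inner T z ^+ 2.
  rewrite -[X in _ * X](sqr_sqrtr (frobenius_inner_ge0 _)) -exprMn.
  have h0 : 0 <= cos eps * frobenius_norm T by rewrite mulr_ge0 // ltW.
  by rewrite lerXn2r // nnegrE // (le_trans h0).
have [i yi] := ynet _ zu; exists i.
have l0 : 0 < (1 / 4 : R) by lra.
have := sine_triangle T l0 zu.2 (yu i).2.
have -> : (1 / 4 : R)^-1 = 4 by field.
rewrite -/(sine2 z (y i)).
have TT := frobenius_inner_ge0 T.
have := ler_wpM2l TT (ltW yi).
have := cos2Dsin2 eps.
rewrite expr_div_n exprMn.
set A := frobenius_inner T T; set S := sine2 _ _.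
set W := frobenius_inner T (y i) ^+ 2; set Z := frobenius_inner T z ^+ 2 in Tz2 *.
move=> cs h1 h2.
have cE : cos eps ^+ 2 = 1 - sin eps ^+ 2 by lra.
rewrite cE -/A in Tz2.
have -> : (5 / 4 : R) ^+ 2 = 25 / 16 by field.
have : A * (sin eps ^+ 2 / 4 ^+ 2) = A * sin eps ^+ 2 / 16 by field.
lra.
Qed.

End Cones.

(** * Counting parameters *)

Section Counting.
Variables (d : nat) (n : 'I_d -> nat) (r : nat).
Hypotheses (r0 : (0 < r)%N) (rn : forall i, (r <= n i)%N).
Variable s : 'I_d -> cp_coord n r.
Hypothesis sK : cancel s (@cp_block d n r).
Local Open Scope nat_scope.

Let rn_gt0 i : 0 < r * n i.
Proof. by rewrite muln_gt0 r0 (leq_trans r0). Qed.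

Lemma card_multi_index : #|{: multi_index n}| = num_entries n.
Proof.
rewrite /num_entries card_dep_ffun /= foldrE big_map big_enum /=.
by apply: eq_bigr => i _; rewrite card_ord.
Qed.

Lemma cp_dim_add : cp_dim s + d = \sum_(i < d) r * n i.
Proof.
have <- : #|cp_coord n r| = \sum_(i < d) r * n i.
  rewrite card_tagged sumnE big_map big_enum /=.
  by apply: eq_bigr => i _; rewrite card_prod !card_ord.
have sinj : injective s by exact: can_inj sK.
rewrite -[X in _ + X](card_ord d) -(card_codom sinj) addnC -(cardC (mem (codom s))).
congr (_ + _); apply: eq_card => x; rewrite !inE; congr (~~ _).
apply/eqP/codomP => [<-|[i ->]]; first by exists (cp_block x).
by rewrite sK.
Qed.

Lemma cp_dimE : cp_dim s = \sum_(i < d) (r * n i).-1.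
Proof.
apply/eqP; rewrite -(eqn_add2r d) cp_dim_add -[X in _ == _ + X](card_ord d) -sum1_card -big_split /=.
by apply/eqP; apply: eq_bigr => i _; rewrite addn1 prednK.
Qed.

Lemma cp_modesE : cp_modes s = #|[set i | 1 < r * n i]%SET|.
Proof.
have cardE i : #|{: 'I_r * 'I_(n i)}| = r * n i by rewrite card_prod !card_ord.
congr #|pred_of_set _|; apply/setP => i; rewrite inE -cardE; apply/imsetP/idP.
  case=> -[i0 u]; rewrite inE /cp_block /= => sx ->.
  rewrite ltnNge; apply/negP => /card_le1_eqP h; move: sx.
  case E: (s i0) => [i1 v].
  have i10 : i1 = i0 by have := sK i0; rewrite E.
  by subst i1; rewrite (h u v) ?inE // eqxx.
move=> /card_gt1P[u [v [_ _ uv]]].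
have [e|ne] := eqVneq (s i) (Tagged (fun i => 'I_r * 'I_(n i))%type u).
  exists (Tagged (fun i => 'I_r * 'I_(n i))%type v) => //.
  by rewrite inE /cp_block /= e eq_Tagged.
by exists (Tagged (fun i => 'I_r * 'I_(n i))%type u) => //; rewrite inE.
Qed.

Lemma num_entries_le_exp : num_entries n <= 2 ^ cp_dim s.
Proof.
rewrite cp_dimE expn_sum /num_entries; apply: leq_prod => i _.
apply: (@leq_trans (r * n i)); first by rewrite leq_pmull.
by rewrite -{1}(prednK (rn_gt0 i)) ltn_expl.
Qed.

(** For each of the q factors i that count, N is n_i times a product in which one
    factor is at least r and q - 2 others are at least 2; sum over i. *)
Lemma num_entries_modes : 2 <= cp_modes s ->
  2 ^ (cp_modes s - 2) * cp_dim s <= cp_modes s * num_entries n.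
Proof.
rewrite cp_modesE; set Q := [set i | _]%SET => Q2.
rewrite cp_dimE (bigID (mem Q)) /= [X in _ + X]big1 ?addn0; last first.
  by move=> i; rewrite inE -leqNgt; have := rn_gt0 i; case: (r * n i) => [|[]].
rewrite -[in X in _ <= X]sum_nat_const big_distrr /=; apply: leq_sum => i iQ.
apply: (@leq_trans (2 ^ (#|Q| - 2) * (r * n i))); first by rewrite leq_mul2l leq_pred orbT.
have n2 j : j \in Q -> 2 <= n j.
  by rewrite inE; have := rn j; case: (n j) => [|[|//]]; case: r r0 => [|[]] //; rewrite ?muln0 ?muln1.
have n1 j : 1 <= n j by exact: leq_trans (rn j).
have [j jQ ji] : exists2 j, j \in Q & j != i.
  have /card_gt1P[u [v [uQ vQ uv]]] := Q2.
  by have [ui|ui] := eqVneq u i; [exists v => //; rewrite -ui eq_sym|exists u].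
rewrite /num_entries (bigD1 i) //= mulnA mulnC leq_mul2l.
apply/orP; right; rewrite (bigD1 j) //= mulnC leq_mul //.
have -> : #|Q| - 2 = #|(Q :\ i) :\ j|.
  have := cardsD1 i Q; rewrite iQ => ->.
  have := cardsD1 j (Q :\ i)%SET; rewrite in_setD1 ji jQ => ->.
  by rewrite !add1n subSS subSS subn0.
rewrite -sum1_card expn_sum big_mkcond [X in _ <= X]big_mkcond /=.
apply: leq_prod => k _; rewrite !in_setD1.
have := n2 k; have := n1 k.
by case: (k \in Q); case: (k != i); case: (k != j) => //= _ ->.
Qed.

End Counting.

(** * Absorbing the numerical factors *)

Lemma bernoulli_ge (R : realType) (x : R) (m : nat) : 0 <= x -> 1 + m%:R * x <= (1 + x) ^+ m.
Proof.
move=> x0; elim: m => [|m IH]; first by rewrite mul0r addr0 expr0.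
rewrite exprS -natr1; apply: le_trans (ler_wpM2l _ IH); last by lra.
have : 0 <= m%:R * x * x by rewrite !mulr_ge0.
lra.
Qed.

Lemma sqr_le_exp2 (m : nat) : ((m + 2) ^ 2 <= 8 * 2 ^ m)%N.
Proof.
case: m => [//|m]; elim: m => [//|m IH].
rewrite [in leqRHS]expnS mulnCA; apply: leq_trans (leq_mul (leqnn 2) IH).
by rewrite -!mulnn; nia.
Qed.

(** With a the integer part of N / p, the right-hand side is at least the p-th
    power of 24 (1 + a/3), by Bernoulli's inequality, and a + 1 exceeds
    2^(q-2) / q. *)
Lemma modes_absorption (R : realType) (p q N : nat) : (0 < p)%N -> (0 < q)%N ->
  ((2 <= q)%N -> (2 ^ (q - 2) * p <= q * N)%N) ->
  q%:R ^+ p <= 24 ^+ p * (4 / 3) ^+ N :> R.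
Proof.
move=> p0 q0 H.
pose a := (N %/ p)%N.
have c1 : 1 <= (4 / 3 : R) by lra.
have qa : (q <= 8 * (a + 1))%N.
  have [q2|q2] := leqP 2 q; last by apply: leq_trans (ltnW q2) _; rewrite addn1 mulnS.
  have qN := H q2.
  have Na : (N < a.+1 * p)%N by exact: ltn_ceil.
  have h : (2 ^ (q - 2) < q * a.+1)%N.
    by rewrite -(ltn_pmul2r p0); apply: leq_ltn_trans qN _; rewrite -mulnA ltn_pmul2l.
  have := sqr_le_exp2 (q - 2); rewrite subnK // => h2.
  rewrite -(leq_pmul2l q0) mulnn; apply: leq_trans h2 _.
  by rewrite mulnCA leq_pmul2l // addn1 ltnW.
have h1 : (q%:R : R) <= 24 * (4 / 3) ^+ a.
  have -> : (4 / 3 : R) = 1 + 3^-1 by field.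
  have b := @bernoulli_ge R 3^-1 a (ltac:(lra)).
  have : q%:R <= (8 * (a + 1))%:R :> R by rewrite ler_nat.
  rewrite natrM natrD; have := ler0n R a; lra.
apply: (@le_trans _ _ ((24 * (4 / 3) ^+ a) ^+ p)).
  have a0 : 0 <= (4 / 3 : R) ^+ a by rewrite exprn_ge0; lra.
  by apply: lerXn2r; rewrite ?nnegrE ?mulr_ge0 ?ler0n.
rewrite exprMn -exprM ler_wpM2l ?exprn_ge0 ?ler0n //.
by apply: ler_weXn2l => //; exact: leq_trunc_div.
Qed.

(** The constants are collected as p-th powers of 2^4, 2^13, 2 and 2^5, hence the
    exponent 23.  For r = 1 the power of c1 on the right is exactly what is
    needed; for r >= 2 the power of r supplies the missing 2^(23 d r^2). *)
Lemma constants_absorption (R : realType) (d r p q N Pp : nat) :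
  (0 < r)%N -> (0 < d)%N -> (0 < p)%N -> (0 < q <= d)%N -> (0 < N)%N ->
  (N <= 2 ^ p)%N -> (p + d = Pp)%N ->
  ((2 <= q)%N -> (2 ^ (q - 2) * p <= q * N)%N) ->
  8 * (8000 * q%:R ^+ 2) ^+ p * N%:R * (3 / 4) ^+ N.-1 * (2 ^+ 23) ^+ (d * r ^ 2) <=
  (2 ^+ 23 * d%:R) ^+ Pp * r%:R ^+ (23 * d ^ 2 * r ^ 2) :> R.
Proof.
move=> r0 d0 p0 /andP[q0 qd] N0 N2 pd H.
have hA := modes_absorption R p0 q0 H.
have d1 : 1 <= d%:R :> R by rewrite ler1n.
have q1 : 0 <= q%:R :> R by rewrite ler0n.
pose c : R := 2 ^+ 23.
have c1 : 1 <= c by rewrite exprn_ege1 // ler1n.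
have c0 : 0 <= c by lra.
have t0 : 0 <= (3 / 4 : R) by lra.
have tN : (3 / 4 : R) ^+ N.-1 = 4 / 3 * (3 / 4) ^+ N.
  by rewrite -[in RHS](prednK N0) exprS; field.
have tt : (4 / 3 : R) ^+ N * (3 / 4) ^+ N = 1.
  by rewrite -exprMn (_ : 4 / 3 * (3 / 4) = 1 :> R) ?expr1n //; field.
have s1 : q%:R ^+ p * (3 / 4 : R) ^+ N <= 24 ^+ p.
  have e34 : 0 <= (3 / 4 : R) ^+ N by rewrite exprn_ge0.
  by have := ler_wpM2r e34 hA; rewrite -mulrA tt mulr1.
have s2 : q%:R ^+ p <= d%:R ^+ Pp :> R.
  apply: (@le_trans _ _ (d%:R ^+ p)).
    by apply: lerXn2r; rewrite ?nnegrE ?ler0n ?ler_nat.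
  by apply: ler_weXn2l => //; rewrite -pd leq_addr.
have s3 : N%:R <= 2 ^+ p :> R by rewrite -natrX ler_nat.
have s4 : 8 * (4 / 3) <= (2 ^+ 4) ^+ p :> R.
  apply: (@le_trans _ _ (2 ^+ 4)); first by rewrite !exprS expr0; lra.
  by rewrite -[leLHS]expr1; apply: ler_weXn2l => //; rewrite exprn_ege1 // ler1n.
have s5 : 8000 ^+ p <= (2 ^+ 13) ^+ p :> R.
  apply: lerXn2r; rewrite ?nnegrE ?ler0n ?exprn_ge0 ?ler0n //.
  rewrite !exprS expr0; lra.
have s6 : 24 ^+ p <= (2 ^+ 5) ^+ p :> R.
  apply: lerXn2r; rewrite ?nnegrE ?ler0n ?exprn_ge0 ?ler0n //.
  rewrite !exprS expr0; lra.
have main : 8 * (8000 * q%:R ^+ 2) ^+ p * N%:R * (3 / 4) ^+ N.-1 <= c ^+ p * d%:R ^+ Pp.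
  rewrite tN exprMn [q%:R ^+ 2 ^+ p]exprAC.
  have -> : 8 * (8000 ^+ p * (q%:R ^+ p) ^+ 2) * N%:R * (4 / 3 * (3 / 4) ^+ N) =
    (8 * (4 / 3)) * 8000 ^+ p * N%:R * (q%:R ^+ p * (3 / 4) ^+ N) * q%:R ^+ p :> R.
    by rewrite expr2; ring.
  have -> : c ^+ p = (2 ^+ 4) ^+ p * (2 ^+ 13) ^+ p * 2 ^+ p * (2 ^+ 5) ^+ p.
    by rewrite -!exprMn /c -!exprD -exprSr -exprD.
  have e8 : 0 <= 8 * (4 / 3) :> R by lra.
  have e8000 : 0 <= 8000 ^+ p :> R by rewrite exprn_ge0 ?ler0n.
  have eq : 0 <= q%:R ^+ p :> R by rewrite exprn_ge0.
  have e34 : 0 <= (3 / 4 : R) ^+ N by rewrite exprn_ge0.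
  have eN : 0 <= N%:R :> R by rewrite ler0n.
  have g1 := mulr_ge0 e8 e8000; have g2 := mulr_ge0 g1 eN.
  have g3 := mulr_ge0 eq e34.
  exact: (ler_pM (mulr_ge0 g2 g3) eq (ler_pM g2 g3 (ler_pM g1 eN (ler_pM e8 e8000 s4 s5) s3)
    (le_trans s1 s6)) s2).
rewrite -/c; apply: (@le_trans _ _ (c ^+ p * d%:R ^+ Pp * c ^+ (d * r ^ 2))).
  by rewrite ler_wpM2r // exprn_ge0.
have -> : c ^+ p * d%:R ^+ Pp * c ^+ (d * r ^ 2) = c ^+ (p + d * r ^ 2) * d%:R ^+ Pp.
  by rewrite exprD mulrAC.
have -> : (c * d%:R) ^+ Pp * r%:R ^+ (23 * d ^ 2 * r ^ 2) =
    c ^+ Pp * r%:R ^+ (23 * d ^ 2 * r ^ 2) * d%:R ^+ Pp.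
  by rewrite exprMn mulrAC.
apply: ler_wpM2r; first by rewrite exprn_ge0 ?ler0n.
have [r2|r2] := leqP 2 r.
  apply: (@le_trans _ _ (c ^+ Pp * c ^+ (d * r ^ 2))).
    rewrite -exprD; apply: ler_weXn2l => //.
    by rewrite leq_add2r -pd leq_addr.
  rewrite ler_wpM2l ?exprn_ge0 // /c -exprM.
  apply: (@le_trans _ _ (r%:R ^+ (23 * (d * r ^ 2)))).
    by apply: lerXn2r; rewrite ?nnegrE ?ler0n ?ler_nat.
  apply: ler_weXn2l; first by rewrite ler1n.
  by rewrite -mulnA leq_mul // leq_mul // -[leqLHS]expn1 leq_pexp2l.
have -> : r = 1%N by apply/eqP; rewrite eqn_leq r0 -ltnS r2.
by rewrite expr1n mulr1 exp1n muln1 pd.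
Qed.

(** * The tube bound *)

Lemma mean_dimE (R : realType) (d : nat) (n : 'I_d -> nat) (r : nat) : (0 < d)%N ->
  r%:R * d%:R * mean_dim R n = (\sum_(i < d) r * n i)%N%:R.
Proof.
move=> d0; have dn0 : d%:R != 0 :> R by rewrite pnatr_eq0 -lt0n.
rewrite /mean_dim mulrA mulfK // -natr_sum -natrM big_distrr //.
Qed.

Lemma cp_tube_bound_ge0 (R : realType) (c1 c2 : R) (d : nat) (n : 'I_d -> nat)
    (r : nat) (eps : R) : 0 <= c1 -> 0 <= sin (2 * eps) ->
  0 <= cp_tube_bound c1 c2 n r eps.
Proof.
move=> c0 s0; rewrite /cp_tube_bound mulr_ge0 ?divr_ge0 ?mulr_ge0 ?powR_ge0 //.
all: by rewrite ?exprn_ge0 ?sqrtr_ge0.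
Qed.

Lemma cp_tube_bound_asymptotics (R : realType) (c1 c2 : R) (d : nat)
    (n : 'I_d -> nat) (r : nat) : (0 < num_entries n)%N ->
  exists C : R, forall eps : R, 0 < eps <= pi / 6 ->
    `|cp_tube_bound c1 c2 n r eps| <=
      C * `|eps `^ ((num_entries n)%:R - r%:R * d%:R * mean_dim R n)|.
Proof.
move=> N0; set N := num_entries n; set rdn := r%:R * d%:R * mean_dim R n.
pose K := ((c1 * d%:R) `^ rdn * r%:R `^ (c2 * d%:R ^+ 2 * r%:R ^+ 2)) /
   (Num.sqrt N%:R * c1 ^+ (d * r ^ 2)).
exists (2 ^+ N.-1 * `|K|) => eps e1; have /andP[e0 e6] := e1.
have [_ s2 _ s34] := small_angle e1.
have S0 : 0 <= sin (2 * eps) by lra.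
have Sle : sin (2 * eps) <= 2 * eps by apply: sin_le_id; rewrite mulr_gt0.
rewrite /cp_tube_bound -/N -/rdn -/K normrM mulrAC ler_wpM2r //.
rewrite ger0_norm ?divr_ge0 ?powR_ge0 ?exprn_ge0 //.
rewrite ger0_norm ?powR_ge0 //.
have -> : N%:R - rdn = N.-1%:R - (rdn - 1) :> R.
  have N0' : (0 < N)%N := N0.
  by rewrite -{1}(prednK N0') -natr1; ring.
rewrite [X in _ <= _ * X]powRB; last by rewrite (gt_eqF e0) implybT.
rewrite powR_mulrn ?(ltW e0) // mulrA -exprMn.
rewrite ler_wpM2r ?invr_ge0 ?powR_ge0 //.
by apply: lerXn2r; rewrite ?nnegrE // mulr_ge0 // ltW.
Qed.

(** The union bound over the net, before any probability: the exponent p of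
    1 / eps is at most r (n_1 + ... + n_d) - 1 because d >= 1. *)
Lemma net_size_le_tube_bound (R : realType) (d : nat) (n : 'I_d -> nat) (r : nat)
    (s : 'I_d -> cp_coord n r) (eps : R) (k : nat) :
  (0 < r)%N -> (forall i, (r <= n i)%N) -> (0 < d)%N -> (0 < cp_dim s)%N ->
  cancel s (@cp_block d n r) -> 0 < eps <= pi / 6 ->
  k%:R <= 4 * (1000 * (cp_modes s)%:R ^+ 2 / (sin eps / 4)) ^+ cp_dim s :> R ->
  k%:R * (2 * Num.sqrt (num_entries n)%:R * (5 / 4 * sin eps) ^+ (num_entries n).-1) <=
  cp_tube_bound (2 ^+ 23) 23 n r eps.
Proof.
move=> r0 rn d0 p0 sK e1.
have pd := cp_dim_add sK; have N2 := num_entries_le_exp r0 rn sK.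
have Hq := num_entries_modes r0 rn sK; have q0 := cp_modes_gt0 p0.
rewrite /cp_tube_bound mean_dimE // -pd; set Pp := (cp_dim s + d)%N.
move: p0 pd N2 Hq q0; set p := cp_dim s; set q := cp_modes s; set N := num_entries n.
move=> p0 pd N2 Hq q0 kle; have /andP[e0 e6] := e1.
have [ele1 s2 _ s34] := small_angle e1.
have N0 : (0 < N)%N.
  by rewrite /N /num_entries; apply: prodn_gt0 => i; exact: leq_trans (rn i).
have qd : (0 < q <= d)%N.
  by rewrite q0 /=; apply: leq_trans (max_card _) _; rewrite card_ord.
have := @constants_absorption R d r p q N Pp r0 d0 p0 qd N0 N2 erefl Hq.
set c : R := 2 ^+ 23; set D := (c * _) ^+ _ * _ => cst.
have c0 : 0 < c by rewrite exprn_gt0 // ltr0n.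
have Pp0 : (0 < Pp)%N by rewrite /Pp addn_gt0 p0.
have sN0 : 0 < Num.sqrt N%:R :> R by rewrite sqrtr_gt0 ltr0n.
have -> : (c * d%:R) `^ Pp%:R * r%:R `^ (23 * d%:R ^+ 2 * r%:R ^+ 2) = D.
  rewrite powR_mulrn ?mulr_ge0 ?(ltW c0) ?ler0n //.
  by rewrite -!natrX -!natrM powR_mulrn ?ler0n.
have -> : Pp%:R - 1 = Pp.-1%:R :> R by rewrite -{1}(prednK Pp0) -natr1 addrK.
rewrite powR_mulrn ?(ltW e0) //.
set S := sin (2 * eps) in s34 *; set t := 5 / 4 * sin eps.
have sig0 : 0 < sin eps by apply: lt_le_trans s2; rewrite divr_gt0.
have t0 : 0 <= t by apply: mulr_ge0 (ltW sig0); rewrite divr_ge0 ?ler0n.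
have q2 : 0 <= q%:R ^+ 2 :> R by rewrite exprn_ge0 // ler0n.
have step1 : k%:R <= 4 * ((8000 * q%:R ^+ 2) ^+ p * eps ^- Pp.-1).
  apply: le_trans kle _; rewrite ler_wpM2l ?ler0n //.
  apply: (@le_trans _ _ ((8000 * q%:R ^+ 2 * eps^-1) ^+ p)).
    have ie : (sin eps)^-1 <= 2 * eps^-1.
      have -> : 2 * eps^-1 = (eps / 2)^-1 by field; rewrite gt_eqF.
      by rewrite lef_pV2 ?posrE // divr_gt0.
    apply: lerXn2r; rewrite ?nnegrE.
    - by rewrite !mulr_ge0 ?ler0n ?invr_ge0 // divr_ge0 ?ler0n // ltW.
    - by rewrite !mulr_ge0 ?ler0n ?invr_ge0 // ltW.
    have -> : 1000 * q%:R ^+ 2 / (sin eps / 4) = 4000 * q%:R ^+ 2 * (sin eps)^-1.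
      by field; rewrite gt_eqF.
    have -> : 8000 * q%:R ^+ 2 * eps^-1 = 4000 * q%:R ^+ 2 * (2 * eps^-1) by ring.
    by apply: ler_wpM2l ie; rewrite mulr_ge0 ?ler0n.
  rewrite exprMn; apply: ler_wpM2l; first by apply/exprn_ge0/mulr_ge0; rewrite ?ler0n.
  rewrite -exprVn; apply: ler_weXn2l; first by rewrite invf_ge1.
  by rewrite -ltnS (prednK Pp0) /Pp -[ltnLHS]addn0 ltn_add2l.
have step2 : t ^+ N.-1 <= (3 / 4) ^+ N.-1 * S ^+ N.-1.
  by rewrite -exprMn; apply: lerXn2r; rewrite ?nnegrE // (le_trans t0).
have t34 : 0 < (3 / 4 : R) by rewrite divr_gt0 ?ltr0n.
have S0 : 0 <= S ^+ N.-1.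
  by apply: exprn_ge0; have := le_trans t0 s34; rewrite (pmulr_rge0 _ t34).
set Q := (8000 * q%:R ^+ 2) ^+ p in cst step1.
have NN : N%:R = Num.sqrt N%:R * Num.sqrt N%:R :> R.
  by rewrite -expr2 sqr_sqrtr ?ler0n.
set X := c ^+ (d * r ^ 2) in cst *.
have X0 : 0 < X by rewrite exprn_gt0.
have step3 : 8 * Q * Num.sqrt N%:R * (3 / 4) ^+ N.-1 <= D / (Num.sqrt N%:R * X).
  rewrite ler_pdivlMr ?mulr_gt0 //; move: cst; rewrite {1}NN.
  by congr (_ <= _); ring.
have iE0 : 0 <= eps ^- Pp.-1 by rewrite invr_ge0 exprn_ge0 // ltW.
have sN := ltW sN0.
apply: (@le_trans _ _ (4 * (Q * eps ^- Pp.-1) *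
    (2 * Num.sqrt N%:R * ((3 / 4) ^+ N.-1 * S ^+ N.-1)))).
  apply: ler_pM => //.
    by apply: mulr_ge0; [apply: mulr_ge0; rewrite ?ler0n|exact: exprn_ge0].
  by apply: ler_wpM2l step2; apply: mulr_ge0; rewrite ?ler0n.
have -> : 4 * (Q * eps ^- Pp.-1) *
    (2 * Num.sqrt N%:R * ((3 / 4) ^+ N.-1 * S ^+ N.-1)) =
  (S ^+ N.-1 / eps ^+ Pp.-1) * (8 * Q * Num.sqrt N%:R * (3 / 4) ^+ N.-1) by ring.
by apply: ler_wpM2l step3; apply: mulr_ge0.
Qed.

Theorem corollary3p4 (R : realType) :
  exists c1 c2 : R, 1 <= c1 /\ 1 <= c2 /\
  forall (d : nat) (n : 'I_d -> nat) (r : nat),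
    (8 <= num_entries n)%N ->
    (forall i : 'I_d, (r <= n i)%N) ->
    (forall (disp : measure_display) (Omega : measurableType disp)
        (P : probability Omega R) (X : multi_index n -> {RV P >-> R}) (eps : R),
      iid_standard_gaussian X ->
      0 < eps <= pi / 6 ->
      let E := [set w | approx_cp_rank_le r eps (random_tensor X w)] in
      measurable E /\ (P E <= (cp_tube_bound c1 c2 n r eps)%:E)%E) /\
    (exists C : R, forall eps : R, 0 < eps <= pi / 6 ->
      `|cp_tube_bound c1 c2 n r eps| <=
        C * `|eps `^ ((num_entries n)%:R - r%:R * d%:R * mean_dim R n)|).
Proof.
exists (2 ^+ 23), 23; split; first by rewrite exprn_ege1 // ler1n.
split; first by rewrite ler1n.
move=> d n r N8 rn; split; last first.
  by apply: cp_tube_bound_asymptotics; exact: leq_trans N8.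
move=> disp Omega P X eps Xiid e1 E; have /andP[e0 e6] := e1.
have pi0 := @pi_gt0 R.
have [ele1 s2 s9 s34] := small_angle e1.
have mE : measurable E.
  by apply: measurable_approx_cp_rank_le; rewrite ltW //=; lra.
split=> //.
have [r0|r0] := posnP r.
  rewrite (_ : E = set0) ?measure0; last first.
    apply/seteqP; split => w //= [_ [T' [/eqP T'0 [a Ta] _]]]; apply: T'0.
    by rewrite Ta; subst r; rewrite big_ord0.
  rewrite lee_fin cp_tube_bound_ge0 ?exprn_ge0 ?ler0n //; lra.
have d0 : (0 < d)%N.
  case: d n rn N8 X Xiid E mE => // n rn; rewrite /num_entries big_ord0 //.
pose i0 : 'I_d := Ordinal d0.
pose s (i : 'I_d) : cp_coord n r :=
  cp_entry (Ordinal r0) (Ordinal (leq_trans r0 (rn i))).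
have sK : cancel s (@cp_block d n r) by [].
have p0 : (0 < cp_dim s)%N.
  rewrite lt0n; apply/negP => /eqP p0.
  by have := leq_trans N8 (num_entries_le_exp r0 rn sK); rewrite p0.
have sig0 : 0 < sin eps by apply: lt_le_trans s2; rewrite divr_gt0.
have eta01 : 0 < sin eps / 4 <= 1.
  by apply/andP; split; [rewrite divr_gt0|lra].
have [k [y [kle yu ynet]]] := cp_net sK p0 eta01.
pose A (i : 'I_k) := [set w | (1 - (5 / 4 * sin eps) ^+ 2) * (\sum_j X j w ^+ 2) <=
   (\sum_j y i j * X j w) ^+ 2].
have NE := card_multi_index n.
have AP i : measurable (A i) /\ (P (A i) <=
    (2 * Num.sqrt (num_entries n)%:R * (5 / 4 * sin eps) ^+ (num_entries n).-1)%:E)%E.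
  rewrite -NE; apply: gaussian_cone_bound => //.
  - by rewrite NE (leq_trans _ N8).
  - by rewrite -(yu i).2; apply: eq_bigr => j _; rewrite expr2.
  - by apply/andP; split; [rewrite mulr_gt0 ?divr_gt0 ?ltr0n|lra].
(* Extended by the empty set to all natural numbers. *)
pose A' j := if insub j is Some i then A i else set0.
have A'E (i : 'I_k) : A' i = A i by rewrite /A' valK.
have EA : E `<=` \big[setU/set0]_(j < k) A' j.
  move=> w /(approx_cp_rank_le_cone i0 e1 yu ynet)[i yi].
  rewrite -bigcup_mkord; exists (i : nat) => //=; rewrite A'E /A /=.
  move: yi; congr (_ * _ <= _ ^+ 2).
    by apply: eq_bigr => j _; rewrite ffunE expr2.
  by apply: eq_bigr => j _; rewrite ffunE mulrC.
have mA' (j : nat) : (j < k)%N -> measurable (A' j).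
  by move=> jk; rewrite -[j]/(val (Ordinal jk)) A'E; case: (AP (Ordinal jk)).
apply: (@le_trans _ _ (P (\big[setU/set0]_(j < k) A' j))).
  apply: le_measure => //; rewrite ?inE //.
  by rewrite -bigcup_mkord; apply: bigcup_measurable => j /= jk; exact: mA'.
apply: (le_trans (Boole_inequality P mA')).
apply: (@le_trans _ _ (\sum_(j < k) (2 * Num.sqrt (num_entries n)%:R *
   (5 / 4 * sin eps) ^+ (num_entries n).-1)%:E)%E).
  by apply: lee_sum => j _; rewrite A'E; case: (AP j).
rewrite sumEFin lee_fin sumr_const card_ord -[leLHS]mulr_natl.
exact: (net_size_le_tube_bound r0 rn d0 p0 sK e1 kle).
Qed.
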